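(* Let $p(x,y)=\sum_{|\alpha| \leq d, |\beta| \leq 2} c_{\alpha,\beta}x^\alpha y^\beta$, with $x\in\mathbb{R}^n$ and $y\in\mathbb{R}^m$, be quadratic and correlatively sparse in $y$. Let $g_1,\ldots,g_q$ be polynomials on $\mathbb{R}^n$ and $\mathcal{K}=\{x\in\mathbb{R}^n: g_1(x)\ge0,\ldots,g_q(x)\ge0\}$. Suppose that the correlative sparsity graph of $p$ with respect to $y$ is chordal with maximal cliques $\mathcal{C}_1,\ldots,\mathcal{C}_t$. For a set $X\subseteq\mathbb{R}^n$ consider the conditions: (a) $\sum_{|\alpha|\leq d, |\beta| = 2} c_{\alpha,\beta}x^\alpha y^\beta > 0$ for all $x\in X$ and $y \in \mathbb{R}^m\setminus \{0\}$; (b) if $p$ is not homogeneous in $y$, then $p(x,y)>0$ for all $x\in X$ and $y \in \mathbb{R}^m$. Then: i) If (a) and (b) hold with $X=\mathcal{K}$, and $\mathcal{K}$ is compact and satisfies the Archimedean condition, there exist SOS polynomials $\sigma_{j,k}(x,y_{\mathcal{C}_k})$, quadratic in the second argument, such that $$p(x,y) = \sum_{k=1}^t \Big[ \sigma_{0,k}\left(x, y_{\mathcal{C}_k}\right) + \sum_{j=1}^q g_{j}(x)\sigma_{j,k}\left(x, y_{\mathcal{C}_k}\right) \Big].$$ ii) If $p$ and the polynomials $g_1,\ldots,g_q$ are homogeneous of even degree in $x$, the set $\mathcal{K} \setminus \{0\}$ is nonempty, and (a) and (b) hold with $X=\mathcal{K} \setminus \{0\}$, there exist an integer $\nu \geq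 0$ and SOS polynomials $\sigma_{j,k}(x,y_{\mathcal{C}_k})$, quadratic in the second argument, such that $$\|x\|^{2\nu} p(x,y) = \sum_{k=1}^t \Big[ \sigma_{0,k}\left(x, y_{\mathcal{C}_k}\right) + \sum_{j=1}^q g_{j}(x)\sigma_{j,k}\left(x, y_{\mathcal{C}_k}\right) \Big].$$
   Context: Polynomials have real coefficients, $x=(x_1,\ldots,x_n)$, $y=(y_1,\ldots,y_m)$, $\|x\|^2=x_1^2+\cdots+x_n^2$; $\alpha\in\mathbb{N}^n$, $\beta\in\mathbb{N}^m$ are multi-indices with $|\alpha|=\sum_i\alpha_i$, $|\beta|=\sum_i\beta_i$. ''Quadratic'' in a variable means of degree at most $2$ in it. The coupling matrix $\mathrm{CSP}_y(p)\in\{0,1\}^{m\times m}$ has $(i,j)$ entry $1$ if $i=j$ or there exist $\alpha,\beta$ with $\beta_i\beta_j\neq 0$ and $c_{\alpha,\beta}\neq0$, and $0$ otherwise. The correlative sparsity graph of $p$ with respect to $y$ is the undirected graph with vertices $\{1,\ldots,m\}$ whose edges are the pairs $i\ne j$ with $[\mathrm{CSP}_y(p)]_{ij}=1$; ''correlatively sparse'' means merely that $\mathrm{CSP}_y(p)$ is sparse. A clique is a set of pairwise adjacent vertices; it is maximal if not contained in another clique. A graph is chordal if every cycle of length at least $4$ has an edge joining two nonconsecutive vertices. For a clique $\mathcal{C}$, $y_{\mathcal{C}}$ is the subvector of $y$ indexed by $\mathcal{C}$. An SOS polynomial is a finite sum of squares of polynomials. The set $\mathcal{K}$ satisfies the Archimedean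 condition if there exist SOS polynomials $\sigma_0,\ldots,\sigma_q$ in $x$ and $r\in\mathbb{R}$ such that $\sigma_0(x)+g_1(x)\sigma_1(x)+\cdots+g_q(x)\sigma_q(x)=r^2-\|x\|^2$. *)

(* Defs.v *)
From HB Require Import structures.
From mathcomp Require Import all_boot all_order all_algebra.
From mathcomp Require Export mpoly.
(* The notations of these files clash with those of mpoly. *)
From mathcomp Require Export -(notations) boolp classical_sets reals topology normedtype.

Set Implicit Arguments.
Unset Strict Implicit.
Unset Printing Implicit Defensive.

Import Order.TTheory GRing.Theory Num.Theory.
Export -(notations) numFieldNormedType.Exports.

Local Open Scope ring_scope.

(* A polynomial in (x, y), with x in R^n and y in R^m, is a polynomial in y
   whose coefficients are polynomials in x: the coefficient c_{alpha,beta} of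
   x^alpha y^beta is (p@_beta)@_alpha. *)
Notation xypoly R n m := {mpoly {mpoly R[n]}[m]}.

Section Polynomials.
Context {R : realType} {n m : nat}.
Implicit Types (p : xypoly R n m) (x : 'rV[R]_n) (y : 'rV[R]_m).

Definition coefxy p (a : 'X_{1..n}) (b : 'X_{1..m}) : R := (p@_b)@_a.

Definition evalx (g : {mpoly R[n]}) x : R := g.@[x ord0].

Definition evalxy p x y : R := evalx p.@[fun j => (y ord0 j)%:MP] x.

Definition quadratic_y p : Prop :=
  forall b : 'X_{1..m}, p@_b != 0 -> (mdeg b <= 2)%N.

(* The terms with |beta| = 2. *)
Definition quadratic_part p : xypoly R n m := pihomog mdeg 2 p.

Definition homog_y p : Prop := exists k : nat, p \is k.-homog.

Definition even_homog_x p : Prop :=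
  exists2 k : nat, ~~ odd k & forall b : 'X_{1..m}, p@_b \is k.-homog.

Definition even_homog (g : {mpoly R[n]}) : Prop :=
  exists2 k : nat, ~~ odd k & g \is k.-homog.

Definition sqnorm_x : {mpoly R[n]} := \sum_(i < n) 'X_i ^+ 2.

Definition CSP p : 'M[nat]_m :=
  \matrix_(i, j) nat_of_bool
    ((i == j) ||
     asbool (exists (a : 'X_{1..n}) (b : 'X_{1..m}),
               (b i * b j != 0)%N /\ coefxy p a b != 0)).

Definition csp_graph p : rel 'I_m := fun i j => (i != j) && (CSP p i j == 1%N).

End Polynomials.

Definition sos (A : pzRingType) (f : A) : Prop :=
  exists s : seq A, f = \sum_(h <- s) h ^+ 2.

(* s(x, y_C) as a polynomial in (x, y): the i-th variable of s in its second
   argument stands for y_j, with j the i-th element of C. *)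
Definition on_clique (R : nzRingType) (n m : nat) (C : {set 'I_m})
    (s : xypoly R n #|C|) : xypoly R n m :=
  s \mPo [tuple 'X_(enum_val i) | i < #|C|].

Section Graphs.
Context {V : finType}.
Implicit Types (e : rel V) (S : {set V}).

Definition clique e S : bool :=
  [forall i in S, forall j in S, (i != j) ==> e i j].

Definition maximal_clique e S : bool := maxset (clique e) S.

Definition chordal e : Prop :=
  forall c : seq V, ucycle e c -> (4 <= size c)%N ->
  exists u v : V,
    [/\ u \in c, v \in c, u != v, (v != next c u) && (u != next c v) & e u v].

End Graphs.

Section SemialgebraicSets.
Context {R : realType} {n q : nat}.

Definition basic_set (g : 'I_q -> {mpoly R[n]}) : set 'rV[R]_n :=
  fun x => forall j, 0 <= evalx (g j) x.

Definition archimedean (g : 'I_q -> {mpoly R[n]}) : Prop :=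
  exists (s0 : {mpoly R[n]}) (s : 'I_q -> {mpoly R[n]}) (r : R),
    [/\ sos s0, forall j, sos (s j) &
        s0 + \sum_(j < q) g j * s j = (r ^+ 2)%:MP - sqnorm_x].

End SemialgebraicSets.

Section Conditions.
Context {R : realType} {n m : nat}.

Definition condition_a (p : xypoly R n m) (X : set 'rV[R]_n) : Prop :=
  forall (x : 'rV[R]_n) (y : 'rV[R]_m),
    X x -> y != 0 -> 0 < evalxy (quadratic_part p) x y.

Definition condition_b (p : xypoly R n m) (X : set 'rV[R]_n) : Prop :=
  ~ homog_y p ->
  forall (x : 'rV[R]_n) (y : 'rV[R]_m), X x -> 0 < evalxy p x y.

(* f = sum_k [s_{0,k}(x, y_{C_k}) + sum_j g_j(x) s_{j,k}(x, y_{C_k})] with all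
   s_{j,k} SOS and quadratic in their second argument. *)
Definition sparse_sos_representation (q t : nat) (g : 'I_q -> {mpoly R[n]})
    (C : 'I_t -> {set 'I_m}) (f : xypoly R n m) : Prop :=
  exists (s0 : forall k : 'I_t, xypoly R n #|C k|)
         (s : 'I_q -> forall k : 'I_t, xypoly R n #|C k|),
    [/\ forall k, sos (s0 k) /\ quadratic_y (s0 k),
        forall j k, sos (s j k) /\ quadratic_y (s j k) &
        f = \sum_(k < t) (on_clique (s0 k) +
                          \sum_(j < q) (g j)%:MP * on_clique (s j k))].

End Conditions.

(* Main.v *)
Require Import Defs.
From mathcomp Require Import all_boot all_order all_algebra.
From mathcomp Require Import ring lra zify.
From mathcomp Require Import -(notations) derive.

Set Implicit Arguments.
Unset Strict Implicit.
Unset Printing Implicit Defensive.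

Import Order.TTheory GRing.Theory Num.Theory.

Local Open Scope ring_scope.

(* Write p = sum_(u, v) P u v z_u z_v with a symmetric polynomial matrix P,
   where z = (y_1, ..., y_m) if p is homogeneous of degree 2 in y, and
   z = (1, y_1, ..., y_m) otherwise, in which case the graph gets an extra
   vertex adjacent to all others. Conditions (a) and (b) say that P is positive
   definite on X, and the graph is still chordal.

   i) Let QM be the quadratic module of the g_j. By the Archimedean condition,
   the products of the 1 - (x_i / r)^2 over distinct i are in QM for some r, and
   hence so is the Bernstein basis of the box [-r, r]^n. On that box,
   P' = P - lam (sum_j g_j (1 - g_j / G)^(2k)) I is positive definite for
   suitable lam, G and k; its Bernstein coefficients of large degree are close to
   its values at grid points, hence positive definite. So P = sum_i b_i C_i
   with b_i in QM and constant positive definite matrices C_i that have the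
   sparsity pattern of P. A chordal graph has a perfect elimination ordering,
   and Cholesky factorization along it causes no fill-in, so that each z^T C_i z
   is a sum of squares of linear forms supported on cliques.

   ii) Let N = ||x||^2. The first part of the argument, applied to K intersected
   with the sphere N = 1, gives P = sum_i b_i C_i with b_i in QM + (1 - N). The
   linear map that multiplies the homogeneous component of degree 2 i by
   N^(h - i) and kills the odd components sends each b_i into QM for large h,
   and P to N^nu P. *)

(** * Chordal graphs *)

Definition simplicial (V : finType) (e : rel V) (S : {set V}) (v : V) : Prop :=
  forall x y, x \in S -> y \in S -> e v x -> e v y -> x != y -> e x y.

(** Amounts to the existence of a perfect elimination ordering: simplicial vertices can be removed
    one after another. Quantifying over all [S] suits the recursion of the Cholesky
    factorization. *)
Definition eliminable (V : finType) (e : rel V) : Prop :=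
  forall S : {set V}, S != set0 -> exists2 v, v \in S & simplicial e S v.

Section Chordal.
Variables (V : finType) (e : rel V).
Hypotheses (esym : symmetric e) (eirr : irreflexive e) (echord : chordal e).

Lemma next_cat (p1 p2 : seq V) (u w : V) :
  uniq (p1 ++ u :: w :: p2) -> next (p1 ++ u :: w :: p2) u = w.
Proof.
move=> h; rewrite -(next_rot (size p1) h) rot_size_cat /=.
by rewrite eqxx.
Qed.

Lemma next_rcons (v u : V) (s : seq V) :
  uniq (v :: rcons s u) -> next (v :: rcons s u) u = v.
Proof.
move=> h; rewrite -(next_rot (size (v :: s)) h).
by rewrite -rcons_cons -cats1 rot_size_cat /= eqxx.
Qed.

(* A shortest such path closes up, through v, to a cycle without chords. *)
Lemma common_neighbor_adjacent (v x y : V) (s : seq V) (D : {set V}) :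
  e v x -> e v y -> x != y ->
  (forall z, z \in D -> z != v /\ ~~ e v z) ->
  path e x (rcons s y) -> {subset s <= D} -> e x y.
Proof.
move=> evx evy nxy hD ps sD; apply/negPn/negP => nexy.
pose good k := [exists p : k.-tuple V, path e x p && (last x p == y) &&
  [forall z in (p : seq V), (z \in D) || (z == y) || (z == x)]].
have ex : exists k, good k.
  exists (size (rcons s y)); apply/existsP; exists (in_tuple (rcons s y)).
  rewrite /= ps last_rcons eqxx /=; apply/forall_inP => z.
  by rewrite mem_rcons inE => /orP[/eqP ->|/sD ->]; rewrite ?eqxx ?orbT.
case: (ex_minnP ex) => k /existsP[p0 /andP[/andP[pp0 /eqP lp0] /forall_inP sp0]] kmin.
have minp (p' : seq V) : path e x p' -> last x p' = y ->
    {subset p' <= (p0 : seq V)} -> (k <= size p')%N.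
  move=> h1 h2 h3; apply: kmin; apply/existsP; exists (in_tuple p').
  rewrite /= h1 h2 eqxx /=; apply/forall_inP => z zp.
  by apply: sp0; apply: h3.
have [p [pp lp up spp szp]] : exists p, [/\ path e x p, last x p = y,
    uniq (x :: p), {subset p <= (p0 : seq V)} & size p = k].
  case: (shortenP pp0) lp0 => p' h1 h2 h3 lp'.
  exists p'; split => //; apply/eqP; rewrite eqn_leq minp // andbT.
  by rewrite -(size_tuple p0) uniq_leq_size //; case/andP: h2.
have sp z : z \in p -> (z \in D) || (z == y).
  move=> zp; have /orP[//|/eqP zx] := sp0 _ (spp _ zp).
  by move: up; rewrite /= -zx zp.
have vx : v != x by apply: contraTneq evx => ->; rewrite eirr.
have vy : v != y by apply: contraTneq evy => ->; rewrite eirr.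
have vp : v \notin p.
  apply/negP => /sp/orP[/hD[]|/eqP vy']; first by rewrite eqxx.
  by rewrite vy' eqxx in vy.
have uc : uniq (v :: x :: p) by rewrite cons_uniq up inE negb_or vx vp.
have [q qE] : exists q, p = rcons q y.
  case/lastP: p lp {up pp spp szp sp vp uc} => [/= xy|q z]; first by rewrite xy eqxx in nxy.
  by rewrite last_rcons => ->; exists q.
have q0 : q != [::].
  by apply: contra nexy => /eqP q0; move: pp; rewrite qE q0 /= andbT.
have cc : cycle e (v :: x :: p).
  by rewrite /= rcons_path evx pp lp esym evy.
have sc : (4 <= size (v :: x :: p))%N.
  by rewrite qE /= size_rcons; case: q q0 {qE}.
(* The cycle through [v], [x] and [p] has no chord: the inner vertices of [p] lie in [D], hence are
   not adjacent to [v], and an edge between nonconsecutive vertices of the path would shorten it. *)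
have chord (a b : V) : a \in v :: x :: p -> b \in x :: p ->
   a != b -> b != next (v :: x :: p) a -> a != next (v :: x :: p) b -> ~~ e a b.
  rewrite inE => /orP[/eqP ->|ap] bp nab nba nab'.
    apply/negP => evb; move: bp; rewrite inE => /orP[/eqP bx|].
      by move: nba; rewrite /= eqxx bx eqxx.
    move=> /sp/orP[/hD[_]|/eqP bE]; first by rewrite evb.
    move: nab'; rewrite bE qE -rcons_cons next_rcons ?eqxx //.
    by rewrite rcons_cons -qE.
  apply/negP => eab.
  (* Jumping from [a'] to [b'] gives another path from [x] to [y], so minimality of [k] leaves
     nothing to skip. The [behead] below is due to paths being stored without their starting
     point. *)
  have cut (a' b' : V) p1 p2 p3 :
      x :: p = p1 ++ a' :: p2 ++ b' :: p3 -> e a' b' -> p2 = [::].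
    move=> pE e'; apply/nilP;
      rewrite /nilp -leqn0 -(leq_add2r (size (p1 ++ a' :: b' :: p3))).
    have szE : (size p2 + size (p1 ++ a' :: b' :: p3) = k.+1)%N.
      rewrite -szp -[(size p).+1]/(size (x :: p)) pE !size_cat /= size_cat /=.
      by move: (size p1) (size p2) (size p3) => i j l; clear; lia.
    rewrite szE add0n.
    have: path e x (behead (p1 ++ a' :: b' :: p3)) /\ 
       last x (behead (p1 ++ a' :: b' :: p3)) = last x p /\
       {subset behead (p1 ++ a' :: b' :: p3) <= p}.
      case: p1 pE {szE} => [|x' p1] /= [xE pE].
        move: pp; rewrite pE cat_path /= last_cat /= => /and3P[_ _ ->].
        rewrite [X in e X]xE e'; do 2?split => //; move=> z zp.
        by rewrite mem_cat zp orbT.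
      move: pp; rewrite pE cat_path /= cat_path /= => /and5P[h1 h2 _ _ h3].
      rewrite cat_path /= h1 h2 e' h3 !last_cat /= last_cat; do 2?split => //.
      by move=> z; rewrite !(mem_cat, inE) => /or3P[] ->; rewrite ?orbT.
    rewrite lp.
    case=> h1 [h2 h3]; have := minp _ h1 h2 (fun z zp => spp z (h3 z zp)).
    by rewrite size_behead; case: p1 {pE h1 h2 h3 szE}.
  have cut' (a' b' : V) p1 p2 : x :: p = p1 ++ a' :: p2 -> b' \in p2 -> e a' b' ->
      next (v :: x :: p) a' = b'.
    move=> pE bq e'; move: pE uc.
    case/path.splitPr: bq => q1 q2 pE.
    rewrite pE (cut _ _ _ _ _ pE e') => uc.
    exact: (@next_cat (v :: p1) q2).
  have [p1 [p2 pE]] : exists p1 p2, x :: p = p1 ++ a :: p2.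
    by case/path.splitPr: ap => p1 p2; exists p1, p2.
  have := bp; rewrite pE mem_cat inE eq_sym (negPf nab) /= => /orP[b1|b2].
    have [r1 [r2 rE]] : exists r1 r2, p1 = r1 ++ b :: r2.
      by case/path.splitPr: b1 => r1 r2; exists r1, r2.
    move: pE; rewrite rE -catA cat_cons => pE.
    by move: nab'; rewrite (cut' _ a _ _ pE) ?eqxx ?mem_cat ?inE ?eqxx ?orbT // esym.
  by move: nba; rewrite (cut' _ b _ _ pE) ?eqxx.
case: (echord (c := v :: x :: p)) => //; first by apply/andP; split.
move=> a [b [ha hb nab /andP[nba nab'] eab]].
move: hb; rewrite inE => /orP[/eqP bv|hb]; last first.
  by have := chord a b ha hb nab nba nab'; rewrite eab.
move: ha; rewrite inE => /orP[/eqP av|ha]; first by rewrite av bv eqxx in nab.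
have := chord b a; rewrite bv esym -bv eab;
have ba : b != a by rewrite eq_sym.
have bc : b \in v :: x :: p by rewrite bv in_cons eqxx.
by have := chord b a bc ha ba nab' nba; rewrite esym eab.
Qed.

(** Dirac's argument. Among the non-neighbours of [v] in [S], let [A] be the component of [u]; let
    [B] be the neighbours of [v] that touch [A]. By the previous lemma [B] is a clique. Induction
    applies to [A :|: B], which misses [v] and contains every neighbour in [S] of a vertex of [A];
    so a vertex of [A] that is simplicial there is simplicial in [S]. *)
Lemma chordal_simplicial_nonadjacent (S : {set V}) (v u : V) :
  v \in S -> u \in S -> u != v -> ~~ e v u ->
  exists w, [/\ w \in S, w != v, ~~ e v w & simplicial e S w].
Proof.
have [k] := ubnP #|S|; elim: k S v u => // k IH S v u leS vS uS uv euv.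
pose D := [set w in S | (w != v) && ~~ e v w].
have uD : u \in D by rewrite inE uS uv.
pose e' : rel V := fun x y => [&& e x y, x \in D & y \in D].
have e'sym : connect_sym e'.
  by apply: sym_connect_sym => x y; rewrite /e' esym; case: (x \in D);
    rewrite ?andbF ?andbT.
pose A := [set w | connect e' u w].
have AD w : w \in A -> w \in D.
  rewrite inE => /connectP[p]; elim/last_ind: p => [_ ->//|p z _].
  by rewrite rcons_path last_rcons => /andP[_ /and3P[_ _ ?]] ->.
have uA : u \in A by rewrite inE connect0.
have Astep a b : a \in A -> b \in D -> e a b -> b \in A.
  move=> aA bD eab; have aD := AD _ aA; move: aA; rewrite !inE => /connect_trans; apply.
  by apply: connect1; rewrite /e' eab aD.
pose B := [set b in S | e v b && [exists a in A, e a b]].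
have Bclique x y : x \in B -> y \in B -> x != y -> e x y.
  rewrite !inE => /and3P[xS evx /exists_inP[a aA eax]] /and3P[yS evy /exists_inP[b bA
    eby]] xy.
  have /connectP[p pp lp] : connect e' a b.
    by apply: (connect_trans (y := u)); [rewrite e'sym|]; move: aA bA; rewrite !inE.
  apply: (@common_neighbor_adjacent v x y (a :: p) D) => //.
  - by move=> z; rewrite inE => /and3P[].
  - rewrite /= esym eax rcons_path -lp eby andbT.
    by apply: sub_path pp => ? ? /and3P[].
  - have := AD _ aA; elim: p a pp {lp aA eax} => [|z p IHp] a /=; first by move=> _ ? ?;
    rewrite inE => /eqP ->.
    move=> /andP[/and3P[_ _ zD] pp] aD w; rewrite inE => /orP[/eqP -> //|].
    exact: IHp pp zD w.
have AN a b : a \in A -> b \in S -> e a b -> b \in A :|: B.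
  move=> aA bS eab; rewrite inE.
  have [bD|nbD] := boolP (b \in D); first by rewrite (Astep a b).
  apply/orP; right; rewrite inE bS /=; apply/andP; split.
    move: nbD; rewrite inE bS /= negb_and !negbK => /orP[/eqP bv|//].
    by have := AD _ aA; rewrite inE -bv esym eab !andbF.
  by apply/exists_inP; exists a.
pose T := A :|: B.
have TS : T \subset S.
  by apply/subsetP => z; rewrite inE => /orP[/AD|]; rewrite inE => /andP[].
have vT : v \notin T.
  apply/negP; rewrite inE => /orP[/AD|]; rewrite inE ?eqxx ?andbF //.
  by rewrite eirr andbF.
have ltT : (#|T| < k)%N.
  rewrite -ltnS; apply: leq_trans leS; rewrite ltnS; apply/proper_card/properP; split=> //.
  by exists v.
suff [w wA wT] : exists2 w, w \in A & simplicial e T w.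
  have := AD _ wA; rewrite inE => /and3P[wS wv ew]; exists w; split => //.
  move=> x y xS yS ewx ewy; apply: wT => //; exact: AN wA _ _.
(* If some [b] in [B] has a non-neighbour in [T], induction gives a simplicial vertex not adjacent
   to [b]; as [B] is a clique, that vertex lies in [A]. *)
have [/exists_inP[b bB /exists_inP[w wT /andP[wb ebw]]]|] :=
  boolP [exists b in B, [exists w in T, (w != b) && ~~ e b w]].
  have [|z [zT zb ebz sz]] := IH T b w ltT _ wT wb ebw; first by rewrite inE bB orbT.
  exists z => //; move: zT; rewrite inE => /orP[//|zB].
  by case: (negP ebz); apply: Bclique; rewrite // eq_sym.
rewrite negb_exists_in => /forall_inP BT.
have {}BT b w : b \in B -> w \in T -> w != b -> e b w.
  move=> /BT; rewrite negb_exists_in => /forall_inP h /h.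
  by rewrite negb_and !negbK => /orP[/eqP ->|//]; rewrite eqxx.
(* From here on every vertex of [B] is adjacent to all of [T], so a simplicial vertex not adjacent
   to a vertex of [A] cannot be in [B]. *)
have [/exists_inP[b bB /exists_inP[w wT /andP[wb ebw]]]|] :=
  boolP [exists b in A, [exists w in A, (w != b) && ~~ e b w]].
  have [||z [zT zb ebz sz]] := IH T b w ltT _ _ wb ebw;
    [by rewrite in_setU bB|by rewrite in_setU wT|].
  exists z => //; move: (zT); rewrite inE => /orP[//|zB].
  by case: (negP ebz); rewrite esym; apply: BT; rewrite ?in_setU ?bB // eq_sym.
rewrite negb_exists_in => /forall_inP AT.
(* In the remaining case [T] is a clique. *)
exists u => // x y xT yT _ _ xy.
have [xB|xB] := boolP (x \in B); first by rewrite BT // eq_sym.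
have [yB|yB] := boolP (y \in B); first by rewrite esym BT.
move: xT yT; rewrite !inE; rewrite inE in xB; rewrite (negPf xB) orbF.
rewrite inE in yB; rewrite (negPf yB) orbF => xA yA.
have := AT x; rewrite inE => /(_ xA); rewrite negb_exists_in => /forall_inP/(_ y).
by rewrite inE => /(_ yA); rewrite negb_and !negbK eq_sym (negPf xy).
Qed.

Lemma chordal_eliminable : eliminable e.
Proof.
move=> S /set0Pn[v vS].
have [/exists_inP[u uS /exists_inP[w wS /andP[wu euw]]]|] :=
  boolP [exists b in S, [exists w in S, (w != b) && ~~ e b w]].
  have [z [zS _ _ sz]] := chordal_simplicial_nonadjacent uS wS wu euw.
  by exists z.
rewrite negb_exists_in => /forall_inP AT.
exists v => // x y xS yS _ _ xy.
have := AT x xS; rewrite negb_exists_in => /forall_inP/(_ y yS).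
by rewrite negb_and !negbK eq_sym (negPf xy).
Qed.

End Chordal.

(** * Sparse Cholesky factorization *)

Definition cone_graph (V : finType) (e : rel V) : rel (option V) :=
  fun a b => match a, b with
             | Some u, Some v => e u v
             | None, None => false
             | _, _ => true
             end.

Lemma cone_graph_sym (V : finType) (e : rel V) :
  symmetric e -> symmetric (cone_graph e).
Proof. by move=> esym [u|] [v|] //=. Qed.

(** The apex [None] is adjacent to every other vertex, so a simplicial vertex of the base graph
    stays simplicial; the apex itself is chosen only when nothing else is left. *)
Lemma cone_graph_eliminable (V : finType) (e : rel V) :
  eliminable e -> eliminable (cone_graph e).
Proof.
move=> eE S S0; have [T0|T0] := eqVneq [set v | Some v \in S] set0.
  have /set0Pn[[v|] vS] := S0.
    by have := in_set0 v; rewrite -T0 inE vS.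
  exists None => // -[x|] [y|] //= xS yS; have := in_set0 x.
  by rewrite -T0 inE xS.
have [v vS sv] := eE _ T0; exists (Some v); first by rewrite inE in vS.
move=> [x|] [y|] //= xS yS ex ey xy.
by apply: sv; rewrite ?inE.
Qed.

Definition sparse (V : finType) (e : rel V) (A : nmodType) (C : V -> V -> A) : Prop :=
  forall u v, u != v -> ~~ e u v -> C u v = 0.

Definition symm (V A : Type) (C : V -> V -> A) : Prop := forall u v, C u v = C v u.

Definition qform (R : pzRingType) (V : finType) (C : V -> V -> R) (z : V -> R) : R :=
  \sum_u \sum_v C u v * (z u * z v).

Definition posdef (R : numDomainType) (V : finType) (C : V -> V -> R) : Prop :=
  forall z, (exists u, z u != 0) -> 0 < qform C z.

Section Cholesky.
Variables (R : rcfType) (V : finType) (e : rel V).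
Hypotheses (esym : symmetric e) (eelim : eliminable e).

Lemma qform_rank1 (w z : V -> R) :
  qform (fun u v => w u * w v) z = (\sum_u w u * z u) ^+ 2.
Proof.
rewrite expr2 mulr_suml; apply: eq_bigr => u _; rewrite mulr_sumr.
by apply: eq_bigr => v _; ring.
Qed.

Lemma qformB (C D : V -> V -> R) z :
  qform (fun u v => C u v - D u v) z = qform C z - qform D z.
Proof.
rewrite /qform -sumrB; apply: eq_bigr => u _; rewrite -sumrB.
by apply: eq_bigr => v _; rewrite mulrBl.
Qed.

(* Eliminating a simplicial vertex creates no fill-in. *)
Lemma cholesky_on (S : {set V}) (C : V -> V -> R) :
  symm C -> sparse e C -> (forall u v, u \notin S -> C u v = 0) ->
  (forall z, (exists2 u, u \in S & z u != 0) -> 0 < qform C z) ->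
  exists2 ws : seq (V -> R),
    forall i, (i < size ws)%N -> clique e [set v | nth (fun=> 0) ws i v != 0] &
    forall u v, C u v = \sum_(w <- ws) w u * w v.
Proof.
have [k] := ubnP #|S|; elim: k S C => // k IH S C leS Csym Csp CS Cpos.
have [S0|S0] := eqVneq S set0.
  by exists [::] => // u v; rewrite big_nil CS // S0 inE.
have [v vS sv] := eelim S0.
have CS' x y : y \notin S -> C x y = 0 by rewrite Csym; apply: CS.
have form1 : qform C (fun u => (u == v)%:R) = C v v.
  rewrite /qform (bigD1 v) //= (bigD1 v) //= eqxx !mulr1 !big1 ?addr0 //.
    by move=> u /negPf uv; rewrite big1 // => y _; rewrite uv mul0r mulr0.
  by move=> u /negPf uv; rewrite uv !mulr0.
have Cvv : 0 < C v v.
  by rewrite -form1; apply: Cpos; exists v; rewrite // eqxx oner_eq0.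
pose w u := C u v / Num.sqrt (C v v).
have ww x y : w x * w y = C x v * C y v / C v v.
  rewrite /w mulrACA -invfM -expr2 sqr_sqrtr //; exact: ltW.
(* The Schur complement of the pivot [C v v]: its row and column at [v] vanish, so the support
   shrinks to [S :\ v]. *)
pose C' x y := C x y - w x * w y.
have C'v x : C' v x = 0.
  by rewrite /C' ww [C x v]Csym mulrAC divff ?gt_eqF // mul1r subrr.
have C'v' x : C' x v = 0.
  by rewrite /C' ww mulfK ?subrr ?gt_eqF.
have [|||||ws wsc wsE] := IH (S :\ v) C'.
- by move: leS; rewrite (cardsD1 v S) vS.
- by move=> x y; rewrite /C' Csym mulrC.
- move=> x y xy exy; rewrite /C' Csp // sub0r ww.
  have [->|Cx] := eqVneq (C x v) 0; first by rewrite !mul0r oppr0.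
  have [->|Cy] := eqVneq (C y v) 0; first by rewrite mulr0 mul0r oppr0.
  have xS : x \in S by apply: contraNT Cx => ?; rewrite CS.
  have yS : y \in S by apply: contraNT Cy => ?; rewrite CS.
  have evx u : u != v -> C u v != 0 -> e v u.
    by move=> uv; apply: contraNT; rewrite esym => h; rewrite Csp.
  case/negP: exy.
  have [xv|xv] := eqVneq x v; first by rewrite xv; apply: evx; rewrite // -xv eq_sym.
  have [yv|yv] := eqVneq y v; first by rewrite yv esym; apply: evx.
  by apply: sv => //; apply: evx.
- move=> x y; rewrite in_setD1 negb_and negbK => /orP[/eqP ->//|xS].
  by rewrite /C' ww !(CS x) // !mul0r subr0.
- move=> z [x]; rewrite in_setD1 => /andP[xv xS] zx.
  (* Changing [z] at [v] does not affect the form of [C'], and this value makes the linear form [w]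
     vanish, so that the forms of [C'] and [C] agree at [z']. *)
  pose z' u := if u == v then - (\sum_(y | y != v) C y v * z y) / C v v else z u.
  have -> : qform C' z = qform C' z'.
    apply: eq_bigr => a _; apply: eq_bigr => b _; rewrite /z'.
    have [->|_] := eqVneq a v; first by rewrite C'v !mul0r.
    by have [->|_] := eqVneq b v; first by rewrite C'v' !mul0r.
  have w0 : \sum_u w u * z' u = 0.
    rewrite (bigD1 v) //= {1}/z' eqxx.
    rewrite [X in _ + X](eq_bigr (fun u => (C u v * z u) / Num.sqrt (C v v))); last first.
      move=> u /negPf uv; by rewrite /z' uv /w mulrAC.
    rewrite -mulr_suml /w mulNr mulrN mulrAC mulrCA divff ?gt_eqF // mulr1.
    by rewrite addNr.
  rewrite qformB qform_rank1 w0 expr0n subr0; apply: Cpos.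
  by exists x; rewrite // /z' (negPf xv).
exists (w :: ws).
  case=> [_|i] /=; last exact: wsc.
  apply/forall_inP => x; rewrite inE mulf_eq0 negb_or => /andP[Cx _].
  apply/forall_inP => y; rewrite inE mulf_eq0 negb_or => /andP[Cy _].
  apply/implyP => xy.
  have xS : x \in S by apply: contraNT Cx => ?; rewrite CS.
  have yS : y \in S by apply: contraNT Cy => ?; rewrite CS.
  have evx u : u != v -> C u v != 0 -> e v u.
    by move=> uv; apply: contraNT; rewrite esym => h; rewrite Csp.
  have [xv|xv] := eqVneq x v; first by rewrite xv; apply: evx; rewrite // -xv eq_sym.
  have [yv|yv] := eqVneq y v; first by rewrite yv esym; apply: evx.
  by apply: sv => //; apply: evx.
by move=> x y; rewrite big_cons -wsE /C' addrC subrK.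
Qed.

(** The factors are addressed by index because functions [V -> R] have no decidable equality, hence
    no boolean membership in a list. *)
Lemma sparse_cholesky (C : V -> V -> R) :
  symm C -> sparse e C -> posdef C ->
  exists2 ws : seq (V -> R),
    forall i, (i < size ws)%N -> clique e [set v | nth (fun=> 0) ws i v != 0] &
    forall u v, C u v = \sum_(w <- ws) w u * w v.
Proof.
move=> Csym Csp Cpos; apply: (@cholesky_on [set: V]) => // [u v|z [u _ zu]].
  by rewrite inE.
by apply: Cpos; exists u.
Qed.

End Cholesky.

(** * Quadratic modules *)

(** Kept abstract in order to cover both the module generated by the [g j] and its sum with the
    ideal of [1 - N]. *)
Definition quadmod (A : pzRingType) (M : A -> Prop) : Prop :=
  [/\ M 1, forall f g, M f -> M g -> M (f + g) & forall a f, M f -> M (a ^+ 2 * f)].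

Section QuadraticModules.
Variables (R : rcfType) (A : comAlgType R) (M : A -> Prop).
Hypothesis qM : quadmod M.

Lemma qm1 : M 1. Proof. by case: qM. Qed.

Lemma qmD f g : M f -> M g -> M (f + g).
Proof. by case: qM => _ h _; apply: h. Qed.

Lemma qm_sqM a f : M f -> M (a ^+ 2 * f).
Proof. by case: qM => _ _; apply. Qed.

Lemma qm_sq a : M (a ^+ 2).
Proof. by rewrite -[_ ^+ 2]mulr1; apply/qm_sqM/qm1. Qed.

Lemma qm0 : M 0.
Proof. by have := qm_sq 0; rewrite expr0n. Qed.

Lemma qm_sum (I : Type) (s : seq I) (P : pred I) (F : I -> A) :
  (forall i, P i -> M (F i)) -> M (\sum_(i <- s | P i) F i).
Proof.
move=> h; elim/big_rec: _ => [|i f Pi fM]; first exact: qm0.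
by apply: qmD => //; apply: h.
Qed.

Lemma qmZ c f : 0 <= c -> M f -> M (c *: f).
Proof.
move=> c0 fM; rewrite -(sqr_sqrtr c0) -mulr_algl -in_algE rmorphXn.
exact: qm_sqM.
Qed.

Lemma qmC c : 0 <= c -> M c%:A.
Proof. by move=> c0; apply: qmZ => //; apply: qm1. Qed.

Lemma qm_sosM a f : sos a -> M f -> M (a * f).
Proof.
by move=> [s ->] fM; rewrite mulr_suml; apply: qm_sum => i _; apply: qm_sqM.
Qed.

(* [D] is within [del] of [1] with respect to [M], and multiplying it by
   [1 - y^2] with [y^2] small keeps it close to [1]. *)
Lemma near1_mul (del eps : R) (D y : A) :
  0 <= del -> 0 <= eps -> M (eps%:A - y ^+ 2) ->
  M (del%:A + (D - 1)) -> M (del%:A - (D - 1)) ->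
  M ((del + eps * del + eps)%:A + (D * (1 - y ^+ 2) - 1)) /\
  M ((del + eps * del + eps)%:A - (D * (1 - y ^+ 2) - 1)).
Proof.
move=> d0 e0 ye h1 h2; split.
  have -> : (del + eps * del + eps)%:A + (D * (1 - y ^+ 2) - 1) =
     (del%:A + (D - 1)) + y ^+ 2 * (del%:A - (D - 1)) + (1 + del) *: (eps%:A - y ^+ 2).
    by rewrite -[(1 + del) *: _]mulr_algl -!in_algE !(rmorphD, rmorphM, rmorph1); ring.
  by do ?apply: qmD => //; [apply: qm_sqM|apply: qmZ; rewrite // addr_ge0].
have -> : (del + eps * del + eps)%:A - (D * (1 - y ^+ 2) - 1) =
   (del%:A - (D - 1)) + y ^+ 2 * (del%:A + (D - 1)) + (1 + del) *: (eps%:A - y ^+ 2)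
     + (y ^+ 2 + y ^+ 2).
  by rewrite -[(1 + del) *: _]mulr_algl -!in_algE !(rmorphD, rmorphM, rmorph1); ring.
by do ?apply: qmD => //; [apply: qm_sqM|apply: qmZ; rewrite // addr_ge0
  |apply: qm_sq|apply: qm_sq].
Qed.

(** A quadratic module need not be closed under products. Here each factor is so close to 1 that the
    whole product stays within 1 of 1 with respect to [M]. *)
Lemma qm_prod_1subsq (n : nat) (eps : R) (y : 'I_n -> A) :
  0 <= eps -> eps <= 2 ^- n -> (forall i, M (eps%:A - y i ^+ 2)) ->
  forall s : seq 'I_n, uniq s -> M (\prod_(i <- s) (1 - y i ^+ 2)).
Proof.
move=> e0 en ye s us.
(* Solves [del k.+1 = 2 * del k + eps] with [del 0 = 0]; this dominates the bound of [near1_mul]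
   since [eps <= 1], and stays below 1 up to [k = n]. *)
pose del k : R := (2 ^+ k - 1) * eps.
have del0 k : 0 <= del k by rewrite mulr_ge0 // subr_ge0 exprn_ege1 // ler1n.
have szs : (size s <= n)%N.
  by rewrite -{2}(card_ord n) cardE uniq_leq_size // => i _; rewrite mem_enum.
have [h1 _] : M ((del (size s))%:A + (\prod_(i <- s) (1 - y i ^+ 2) - 1)) /\
        M ((del (size s))%:A - (\prod_(i <- s) (1 - y i ^+ 2) - 1)).
  elim: s {us} szs => [|i s IH] szs.
    by rewrite big_nil /del subrr mul0r scale0r subrr subr0 addr0; split; exact: qm0.
  have [||h1 h2] := @near1_mul (del (size s)) eps _ (y i) _ _ (ye i) (IH (ltnW szs)).1
    (IH (ltnW szs)).2 => //.
  have le : 0 <= del (size s).+1 - (del (size s) + eps * del (size s) + eps).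
    have e1 : eps <= 1.
      by apply: le_trans en _; rewrite invf_le1 ?exprn_gt0 // exprn_ege1 // ler1n.
    have := ler_wpM2r (del0 (size s)) e1.
    by rewrite mul1r -subr_ge0 /del exprS => h; rewrite (le_trans h) // le_eqVlt;
      apply/orP; left; apply/eqP; ring.
  have dE : (del (size s).+1)%:A = (del (size s) + eps * del (size s) + eps)%:A
      + (del (size s).+1 - (del (size s) + eps * del (size s) + eps))%:A :> A.
    by rewrite -scalerDl addrC subrK.
  by rewrite /= big_cons [X in X - 1]mulrC dE ![in _%:A + _%:A + _]addrAC; split;
    apply: qmD => //; exact: qmC.
have -> : \prod_(i <- s) (1 - y i ^+ 2) =
  ((del (size s))%:A + (\prod_(i <- s) (1 - y i ^+ 2) - 1)) + (1 - del (size s))%:A.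
  by rewrite -!in_algE !(rmorphB, rmorph1); ring.
apply: qmD => //; apply: qmC; rewrite subr_ge0 /del.
have : (2 ^+ size s - 1) * eps <= 2 ^+ n * 2 ^- n.
  apply: ler_pM => //; first by rewrite subr_ge0 exprn_ege1 // ler1n.
  rewrite lerBlDr (le_trans (_ : _ <= 2 ^+ n)) ?ler_weXn2l ?ler1n //.
  by rewrite lerDl ler01.
by rewrite divff ?expf_neq0 ?pnatr_eq0.
Qed.

(** Even powers go into the squares. A leftover factor is handled by [u = u ^+ 2 + u * (1 - u)] or
    by the same identity for [1 - u]. *)
Lemma bernstein_factor (u : A) (a b : nat) :
  exists p q, u ^+ a * (1 - u) ^+ b = p ^+ 2 + q ^+ 2 * (u * (1 - u)).
Proof.
rewrite -(odd_double_half a) -(odd_double_half b) -!muln2 !exprD !exprM.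
set c := u ^+ a./2; set d := (1 - u) ^+ b./2.
case: (odd a); case: (odd b); rewrite ?expr0 ?expr1 ?mul1r.
- by exists 0, (c * d); ring.
- by exists (c * d * u), (c * d); ring.
- by exists (c * d * (1 - u)), (c * d); ring.
- by exists (c * d), 0; ring.
Qed.

(** The factors are replaced one at a time: each becomes a square plus a square times a multiple of
    [w i]. The list [t] collects the [w i] already produced; they are distinct, so the hypothesis on
    their products applies at the end. *)
Lemma qm_bernstein (n : nat) (u w : 'I_n -> A) (c : R) :
  0 <= c -> (forall i, u i * (1 - u i) = c *: w i) ->
  (forall s : seq 'I_n, uniq s -> M (\prod_(i <- s) w i)) ->
  forall a b : 'I_n -> nat, M (\prod_i (u i ^+ a i * (1 - u i) ^+ b i)).
Proof.
move=> c0 uw wM a b.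
suff h (s t : seq 'I_n) : uniq (s ++ t) ->
    M (\prod_(i <- s) (u i ^+ a i * (1 - u i) ^+ b i) * \prod_(i <- t) w i).
  have := h (index_enum 'I_n) [::]; rewrite cats0 big_nil mulr1; apply.
  exact: index_enum_uniq.
elim: s t => [|i s IH] t /=; first by rewrite big_nil mul1r; apply: wM.
move=> /andP[ist ust]; rewrite big_cons.
have [p [q ->]] := bernstein_factor (u i) (a i) (b i).
rewrite uw; set F := \prod_(j <- s) _; set W := \prod_(j <- t) _.
have -> : (p ^+ 2 + q ^+ 2 * (c *: w i)) * F * W =
    p ^+ 2 * (F * W) + q ^+ 2 * (c *: (F * (w i * W))).
  by rewrite -[c *: w i]mulr_algl -[c *: (F * _)]mulr_algl; ring.
apply: qmD; first by apply: qm_sqM; exact: IH.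
apply: qm_sqM; apply: qmZ => //.
have -> : w i * W = \prod_(j <- i :: t) w j by rewrite big_cons.
apply: IH.
by rewrite (perm_uniq (permEl (perm_catCA s [:: i] t))) /= ist ust.
Qed.

End QuadraticModules.

(** * Bernstein expansions *)

(** Multiplied by the factorial of [i], both sides become [N ^_ (i + j)]. *)
Lemma ffact_bin (N j i : nat) : (j + i <= N)%N ->
  ((i + j) ^_ j * 'C(N, i + j) = N ^_ j * 'C(N - j, i))%N.
Proof.
move=> jiN; apply/eqP; rewrite -(eqn_pmul2r (fact_gt0 i)) -!mulnA bin_ffact.
have E : ((i + j) ^_ j * i`! = (i + j)`!)%N.
  by rewrite -[X in X`!](addnK j i) ffact_fact // leq_addl.
have -> : ((i + j) ^_ j * ('C(N, i + j) * i`!) = 'C(N, i + j) * (i + j)`!)%N.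
  by rewrite -E mulnCA.
rewrite bin_ffact; apply/eqP; elim: i {E} jiN => [|i IH] jiN; first by rewrite muln1.
rewrite addSn !ffactnSr IH; last by lia.
by rewrite mulnA; congr (_ * _)%N; lia.
Qed.

Section OneVariable.
Variables (R : numFieldType) (A : comAlgType R).

(** Multiply [u ^+ j] by [(1 - u + u) ^+ (N - j)] and use the binomial theorem. The terms with
    [k < j] have coefficient 0. *)
Lemma bernstein_expansion1 (u : A) (j N : nat) : (j <= N)%N ->
  u ^+ j = \sum_(k < N.+1) ((k ^_ j)%:R / (N ^_ j)%:R) *:
     (u ^+ k * (1 - u) ^+ (N - k) *+ 'C(N, k)).
Proof.
move=> jN; have Nj0 : (N ^_ j)%:R != 0 :> R by rewrite pnatr_eq0 -lt0n ffact_gt0.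
rewrite -(big_mkord xpredT (fun k => ((k ^_ j)%:R / (N ^_ j)%:R) *:
     (u ^+ k * (1 - u) ^+ (N - k) *+ 'C(N, k)))).
rewrite (big_cat_nat _ (n := j)) //=; last exact: leqW.
rewrite big_nat big1 ?add0r; last first.
  by move=> k /andP[_ kj]; rewrite ffact_small // mul0r scale0r.
rewrite -{2}[j]add0n big_addn subSn // big_mkord.
have -> : u ^+ j = u ^+ j * (1 - u + u) ^+ (N - j) by rewrite subrK expr1n mulr1.
rewrite exprDn mulr_sumr; apply: eq_bigr => i _.
have ij : (j + i <= N)%N by have := ltn_ord i; lia.
rewrite -[_ *+ 'C(N - j, i)]scaler_nat -[_ *+ 'C(N, i + j)]scaler_nat -scalerAr scalerA.
have -> : (N - (i + j) = N - j - i)%N by lia.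
rewrite exprD [u ^+ i * u ^+ j]mulrC -[u ^+ j * u ^+ i * _]mulrA [u ^+ i * _]mulrC;
  congr (_ *: _).
by rewrite mulrAC -natrM ffact_bin // natrM mulrAC divff // mul1r.
Qed.

End OneVariable.

(** With explicit thresholds, finitely many conditions are met together by taking a maximum. *)
Definition ultimately (Q : nat -> Prop) : Prop :=
  exists N0, forall N, (N0 <= N)%N -> Q N.

Lemma ultimately_ge k : ultimately (fun N => k <= N)%N.
Proof. by exists k. Qed.

Lemma ultimatelyT (Q : nat -> Prop) : (forall N, Q N) -> ultimately Q.
Proof. by move=> h; exists 0%N. Qed.

Lemma ultimately_imp2 (Q1 Q2 Q3 : nat -> Prop) :
  (forall N, Q1 N -> Q2 N -> Q3 N) ->
  ultimately Q1 -> ultimately Q2 -> ultimately Q3.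
Proof.
move=> h [N1 h1] [N2 h2]; exists (maxn N1 N2) => N.
by rewrite geq_max => /andP[/h1 ? /h2 ?]; apply: h.
Qed.

Lemma ultimately_imp (Q1 Q2 : nat -> Prop) :
  (forall N, Q1 N -> Q2 N) -> ultimately Q1 -> ultimately Q2.
Proof. by move=> h [N0 h0]; exists N0 => N /h0/h. Qed.

Lemma ultimately_seq (T : eqType) (s : seq T) (Q : T -> nat -> Prop) :
  (forall i, i \in s -> ultimately (Q i)) ->
  ultimately (fun N => forall i, i \in s -> Q i N).
Proof.
elim: s => [|i s IH] h; first exact: ultimatelyT.
have hs j : j \in s -> ultimately (Q j) by move=> js; apply: h; rewrite inE js orbT.
apply: (@ultimately_imp2 (Q i) (fun N => forall j, j \in s -> Q j N)); last 2 first.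
- exact/h/mem_head.
- exact: IH.
by move=> N Qi Qs j; rewrite inE => /orP[/eqP ->|/Qs].
Qed.

Lemma ultimately_fin (I : finType) (Q : I -> nat -> Prop) :
  (forall i, ultimately (Q i)) -> ultimately (fun N => forall i, Q i N).
Proof.
move=> h; have := @ultimately_seq _ (enum I) Q (fun i _ => h i).
by apply: ultimately_imp => N hN i; apply: hN; rewrite mem_enum.
Qed.

Section Bernstein.
Variables (R : realType).

Lemma dist_mul (a a' b b' e e' : R) :
  0 <= a <= 1 -> 0 <= b' <= 1 -> `|a - b| <= e -> `|a' - b'| <= e' ->
  `|a * a' - b * b'| <= e + e'.
Proof.
move=> /andP[a0 a1] /andP[b0 b1] h h'.
have -> : a * a' - b * b' = (a - b) * b' + a * (a' - b') by ring.
rewrite (le_trans (ler_normD _ _)) // !normrM lerD //.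
  by rewrite (le_trans _ h) // [`|b'|]ger0_norm // ler_piMr.
by rewrite (le_trans _ h') // [`|a|]ger0_norm // ler_piMl.
Qed.

Lemma dist_prod (I : Type) (s : seq I) (a b : I -> R) (e : R) :
  (forall i, 0 <= a i <= 1) -> (forall i, 0 <= b i <= 1) ->
  (forall i, `|a i - b i| <= e) ->
  `|\prod_(i <- s) a i - \prod_(i <- s) b i| <= (size s)%:R * e.
Proof.
move=> ha hb hab; elim: s => [|i s IH]; first by rewrite !big_nil subrr normr0 mul0r.
rewrite !big_cons /= -natr1 [_ + 1]addrC mulrDl mul1r; apply: dist_mul => //.
elim: s {IH} => [|j s /andP[IH0 IH1]]; first by rewrite big_nil ler01 lexx.
rewrite big_cons; have /andP[b0 b1] := hb j.
by rewrite mulr_ge0 //= mulr_ile1.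
Qed.

Lemma ffact_ratio_bounds (j k N : nat) : (k <= N)%N ->
  0 <= ((k ^_ j)%:R / (N ^_ j)%:R : R) <= 1.
Proof.
move=> kN; rewrite divr_ge0 ?ler0n //=.
have [jN|jN] := leqP j N; last by rewrite (ffact_small jN) invr0 mulr0 ler01.
rewrite ler_pdivrMr ?ltr0n ?ffact_gt0 // mul1r ler_nat.
elim: j {jN} => [|j IH] //; rewrite !ffactnSr leq_mul //; lia.
Qed.

Lemma ratio_bounds (k N : nat) : (k <= N)%N -> 0 <= (k%:R / N%:R : R) <= 1.
Proof.
move=> kN; rewrite divr_ge0 ?ler0n //=; case: N kN => [|N] kN.
  by rewrite invr0 mulr0 ler01.
by rewrite ler_pdivrMr ?ltr0n // mul1r ler_nat.
Qed.

Lemma ultimately_natr (c : R) : ultimately (fun N => c <= N%:R).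
Proof.
exists (Num.bound `|c|) => N hN; apply: le_trans (ler_norm c) _; apply: ltW.
by apply: lt_le_trans (archi_boundP (normr_ge0 c)) _; rewrite ler_nat.
Qed.

(** By induction on [j]: the new factor [(k - j) / (N - j)] differs from [k / N] by at most
    [j / (N - j)], uniformly in [k]. *)
Lemma ffact_ratio_close (j : nat) (e : R) : 0 < e ->
  ultimately (fun N => forall k, (k <= N)%N ->
    `|(k ^_ j)%:R / (N ^_ j)%:R - (k%:R / N%:R) ^+ j| <= e).
Proof.
elim: j e => [|j IH] e e0.
  by apply: ultimatelyT => N k _;
    rewrite !ffactn0 divff ?oner_eq0 // expr0 subrr normr0 ltW.
have e2 : 0 < e / 2 by rewrite divr_gt0.
have hN := ultimately_imp2 (fun _ a b => conj a b) (ultimately_ge j.+1)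
     (ultimately_natr (j%:R + j%:R / (e / 2))).
apply: ultimately_imp2 (IH _ e2) hN => N h [jN eN] k kN.
rewrite !ffactnSr !natrM invfM mulrACA exprSr [e](splitr e).
apply: dist_mul; [exact: ffact_ratio_bounds|exact: ratio_bounds|exact: h|].
have Nj0 : 0 < N%:R - j%:R :> R by rewrite subr_gt0 ltr_nat.
have N0 : 0 < N%:R :> R by rewrite ltr0n; case: (N) jN.
have j0 : 0 <= j%:R :> R by [].
have jNe : j%:R / (N%:R - j%:R) <= e / 2.
  rewrite ler_pdivrMr // mulrC -ler_pdivrMr //; lra.
have jNe' : j%:R / N%:R <= e / 2.
  by rewrite (le_trans _ jNe) // ler_wpM2l // lef_pV2 ?posrE // gerBl.
rewrite [(N - j)%:R]natrB ?(ltnW jN) //.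
(* For [k <= j] the subtraction of naturals truncates to 0, and the difference is just [k / N]. *)
have [kj|jk] := leqP k j.
  rewrite (eqP kj) mul0r sub0r normrN ger0_norm; last by rewrite divr_ge0.
  by rewrite (le_trans _ jNe') // ler_wpM2r ?invr_ge0 ?(ltW N0) // ler_nat.
have -> : (k - j)%:R / (N%:R - j%:R) - k%:R / N%:R =
    - (j%:R / (N%:R - j%:R) * ((N%:R - k%:R) / N%:R)) :> R.
  by rewrite natrB ?(ltnW jk) //; field; rewrite !gt_eqF.
rewrite normrN ger0_norm; last first.
  by rewrite !mulr_ge0 ?invr_ge0 ?(ltW Nj0) ?(ltW N0) // subr_ge0 ler_nat.
rewrite (le_trans _ jNe) // ler_piMr ?divr_ge0 ?(ltW Nj0) //.
by rewrite ler_pdivrMr // mul1r gerBl.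
Qed.

Variable n : nat.
Implicit Types (P : {mpoly R[n]}) (r : R) (i : 'I_n).

(** The affine coordinate that maps the side [[-r, r]] of the box onto [[0, 1]]. *)
Definition ucoord r i : {mpoly R[n]} := (r *+ 2)^-1 *: ('X_i + r%:MP).

Definition bernstein_basis r N (k : {ffun 'I_n -> 'I_N.+1}) : {mpoly R[n]} :=
  \prod_i (ucoord r i ^+ k i * (1 - ucoord r i) ^+ (N - k i) *+ 'C(N, k i)).

Definition to_ucoord r P : {mpoly R[n]} :=
  P \mPo [tuple (r *+ 2) *: 'X_i - r%:MP | i < n].

(** Obtained by applying [bernstein_expansion1] to every variable of every monomial. If [N] is below
    an exponent, [N ^_ a i] is 0 and so is its inverse; the expansion is therefore stated for large
    [N] only. *)
Definition bernstein_coef r N P (k : {ffun 'I_n -> 'I_N.+1}) : R :=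
  \sum_(a <- msupp (to_ucoord r P)) (to_ucoord r P)@_a *
     \prod_i ((k i ^_ a i)%:R / (N ^_ a i)%:R).

Definition grid_point r N (k : {ffun 'I_n -> 'I_N.+1}) : 'rV[R]_n :=
  \row_i (r *+ 2 * ((k i)%:R / N%:R) - r).

Lemma to_ucoordK r P : r != 0 -> to_ucoord r P \mPo [tuple ucoord r i | i < n] = P.
Proof.
move=> r0; rewrite /to_ucoord [X in X \mPo _ = _]comp_mpolyEX raddf_sum /=.
rewrite [RHS]mpolyE; apply: eq_bigr => a _; rewrite linearZ /=; congr (_ *: _).
rewrite comp_mpolyX rmorph_prod mpolyXE_id; apply: eq_bigr => i _.
rewrite rmorphXn; congr (_ ^+ _); rewrite tnth_mktuple.
rewrite rmorphB /= linearZ /= comp_mpolyXU comp_mpolyC -tnth_nth tnth_mktuple.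
by rewrite /ucoord scalerA divff ?scale1r ?addrK // mulrn_eq0.
Qed.

Lemma bernstein_expansion r P : r != 0 ->
  ultimately (fun N =>
    P = \sum_k bernstein_coef r P k *: @bernstein_basis r N k).
Proof.
move=> r0; have := @ultimately_seq _ (msupp (to_ucoord r P))
  (fun a N => forall i, (a i <= N)%N) _; case.
  by move=> a _; apply: ultimately_fin => i; apply: ultimately_ge.
move=> N0 hN; exists N0 => N /hN {}hN.
rewrite -[LHS](to_ucoordK _ r0) comp_mpolyE.
under [RHS]eq_bigr do rewrite /bernstein_coef scaler_suml.
rewrite exchange_big /=; apply: eq_big_seq => a /hN aN.
under [RHS]eq_bigr do rewrite -scalerA.
rewrite -scaler_sumr; congr (_ *: _).
under eq_bigr => i _ do rewrite tnth_mktuple (bernstein_expansion1 _ (aN i)).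
rewrite bigA_distr_bigA; apply: eq_bigr => k _.
by rewrite scaler_prod.
Qed.

Lemma bernstein_coef_close r P (e : R) : 0 < e ->
  ultimately (fun N => forall k : {ffun 'I_n -> 'I_N.+1},
    `|bernstein_coef r P k - evalx P (grid_point r k)| <= e).
Proof.
move=> e0; pose B := \sum_(a <- msupp (to_ucoord r P)) `|(to_ucoord r P)@_a|.
have B0 : 0 <= B by apply: sumr_ge0.
(* The error is at most [n * e'] on each monomial, and [B] is the total weight of the monomials; the
   added ones keep the denominator positive. *)
pose e' := e / (n.+1%:R * (B + 1)).
have e'0 : 0 < e' by rewrite divr_gt0 // mulr_gt0 // ltr_wpDl.
have := @ultimately_seq _ (msupp (to_ucoord r P))
  (fun a N => forall i, forall k, (k <= N)%N ->
    `|(k ^_ (a i))%:R / (N ^_ (a i))%:R - (k%:R / N%:R) ^+ (a i)| <= e') _; case.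
  by move=> a _; apply: ultimately_fin => i; apply: ffact_ratio_close.
move=> N0 hN; exists N0 => N /hN {}hN k.
have -> : evalx P (grid_point r k) = (to_ucoord r P).@[fun i => (k i)%:R / N%:R].
  rewrite /to_ucoord comp_mpoly_meval; apply: meval_eq => i.
  by rewrite tnth_mktuple mevalB mevalZ mevalXU mevalC mxE.
rewrite mevalE /bernstein_coef -sumrB.
apply: le_trans (ler_norm_sum _ _ _) _.
apply: (@le_trans _ _ (\sum_(a <- msupp (to_ucoord r P)) `|(to_ucoord r P)@_a| * (n%:R *
  e'))).
  rewrite big_seq [leRHS]big_seq; apply: ler_sum => a aP.
  rewrite -mulrBr normrM ler_wpM2l //.
  have sz : size (index_enum 'I_n) = n by rewrite /index_enum -enumT size_enum_ord.
  rewrite -[X in _ <= X%:R * _]sz.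
  apply: dist_prod => i.
  - by apply: ffact_ratio_bounds; rewrite -ltnS.
  - have /andP[h0 h1] : 0 <= ((k i)%:R / N%:R : R) <= 1 by apply: ratio_bounds;
    rewrite -ltnS.
    by rewrite exprn_ge0 //= exprn_ile1.
  - by apply: hN => //; rewrite -ltnS.
rewrite -mulr_suml -/B /e'.
have -> : B * (n%:R * (e / (n.+1%:R * (B + 1)))) = e * ((B * n%:R) / (n.+1%:R * (B + 1))).
  by field; rewrite nat1r pnatr_eq0 /= gt_eqF // ltr_wpDl.
rewrite ler_piMr ?(ltW e0) // ler_pdivrMr ?mulr_gt0 ?ltr_wpDl // mul1r mulrC.
by rewrite ler_pM ?ler0n ?ler_nat // lerDl ler01.
Qed.

(** With [u] the coordinate [ucoord r i], the product [u * (1 - u)] is a quarter of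
    [1 - (x_i / r) ^+ 2], which is the situation of [qm_bernstein]. *)
Lemma qm_bernstein_basis (M : {mpoly R[n]} -> Prop) r N (k : {ffun 'I_n -> 'I_N.+1}) :
  quadmod M -> 0 < r ->
  (forall s : seq 'I_n, uniq s -> M (\prod_(i <- s) (1 - (r^-1 *: 'X_i) ^+ 2))) ->
  M (bernstein_basis r k).
Proof.
move=> qM r0 hs; rewrite /bernstein_basis.
under eq_bigr do rewrite -scaler_nat.
rewrite scaler_prod; apply: (qmZ qM); first by apply: prodr_ge0 => i _; rewrite ler0n.
apply: (@qm_bernstein R _ M qM n _ _ 4^-1 _ _ hs); first by rewrite invr_ge0.
move=> i; rewrite /ucoord exprZn.
have r2 : r *+ 2 != 0 by rewrite mulrn_eq0 /= gt_eqF.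
have -> : 1 - (r *+ 2)^-1 *: ('X_i + r%:MP) = (r *+ 2)^-1 *: (r%:MP - 'X_i) :> {mpoly R[n]}.
  apply: (scalerI r2); rewrite scalerBr !scalerA divff // !scale1r.
  by rewrite mulr2n scalerDl -mul_mpolyC mulr1; ring.
rewrite -scalerAl -scalerAr scalerA.
have -> : ('X_i + r%:MP) * (r%:MP - 'X_i) = (r ^+ 2) *: (1 - r^-1 ^+ 2 *: 'X_i ^+ 2) :>
  {mpoly R[n]}.
  rewrite scalerBr scalerA exprVn divff ?expf_neq0 ?gt_eqF // scale1r.
  by rewrite -mul_mpolyC mulr1 rmorphXn /=; ring.
rewrite scalerA; congr (_ *: _); field.
by rewrite gt_eqF.
Qed.

End Bernstein.

(** * Positivity margins *)

Section Margin.
Variables (R : realType) (T : topologicalType).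

Lemma continuous_add (f g : T -> R) :
  continuous f -> continuous g -> continuous (fun t => f t + g t).
Proof. by move=> hf hg x; exact: (@continuousD R R^o T f g x (hf x) (hg x)). Qed.

Lemma continuous_opp (f : T -> R) : continuous f -> continuous (fun t => - f t).
Proof. by move=> hf x; exact: (@continuousN R R^o T f x (hf x)). Qed.

Lemma continuous_mul (f g : T -> R) :
  continuous f -> continuous g -> continuous (fun t => f t * g t).
Proof. by move=> hf hg x; exact: (@continuousM R T f g x (hf x) (hg x)). Qed.

Lemma continuous_bigsum (I : Type) (s : seq I) (F : I -> T -> R) :
  (forall i, continuous (F i)) -> continuous (fun t => \sum_(i <- s) F i t).
Proof.
move=> h; elim: s => [|i s IH].
  rewrite (_ : (fun t => \sum_(j <- [::]) F j t) = (fun=> 0)); last first.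
    by apply: boolp.funext => t; rewrite big_nil.
  by move=> x; exact: cst_continuous.
rewrite (_ : (fun t => \sum_(j <- i :: s) F j t) =
     (fun t => F i t + \sum_(j <- s) F j t)); last first.
  by apply: boolp.funext => t; rewrite big_cons.
exact: continuous_add.
Qed.

Lemma continuous_bigprod (I : Type) (s : seq I) (F : I -> T -> R) :
  (forall i, continuous (F i)) -> continuous (fun t => \prod_(i <- s) F i t).
Proof.
move=> h; elim: s => [|i s IH].
  rewrite (_ : (fun t => \prod_(j <- [::]) F j t) = (fun=> 1)); last first.
    by apply: boolp.funext => t; rewrite big_nil.
  by move=> x; exact: cst_continuous.
rewrite (_ : (fun t => \prod_(j <- i :: s) F j t) =
     (fun t => F i t * \prod_(j <- s) F j t)); last first.
  by apply: boolp.funext => t; rewrite big_cons.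
exact: continuous_mul.
Qed.

Lemma continuous_exp (f : T -> R) k : continuous f -> continuous (fun t => f t ^+ k).
Proof.
move=> h; rewrite (_ : (fun t => f t ^+ k) = (fun t => \prod_(i < k) f t)).
  exact: continuous_bigprod.
by apply: boolp.funext => t; rewrite prodr_const card_ord.
Qed.

Lemma continuous_meval (n : nat) (P : {mpoly R[n]}) (h : 'I_n -> T -> R) :
  (forall i, continuous (h i)) -> continuous (fun t => P.@[fun i => h i t]).
Proof.
move=> hc.
rewrite (_ : (fun t => P.@[fun i => h i t]) =
  (fun t => \sum_(a <- msupp P) P@_a * \prod_i (h i t) ^+ a i)); last first.
  by apply: boolp.funext => t; rewrite mevalE.
apply: continuous_bigsum => a; apply: continuous_mul; first by move=> x;
  exact: cst_continuous.
by apply: continuous_bigprod => i; apply: continuous_exp.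
Qed.

(** Induction on the constraints: a constraint [g i] is absorbed by replacing [f] with the maximum
    of [f] and [- g i], which is positive wherever the others hold. Without constraints, the minimum
    of [f] is the margin. *)
Lemma compact_margin (A : set T) (I : eqType) (s : seq I) (g : I -> T -> R) (f : T -> R) :
  compact A -> continuous f -> (forall i, continuous (g i)) ->
  (forall a, A a -> (forall i, i \in s -> 0 <= g i a) -> 0 < f a) ->
  exists2 mu, 0 < mu &
    forall a, A a -> (forall i, i \in s -> - mu <= g i a) -> mu <= f a.
Proof.
move=> cA cf cg; elim: s f cf => [|i s IH] f cf h.
  have [A0|A0] := boolp.pselect (nonempty A); last first.
    by exists 1 => // a Aa; case: A0; exists a.
  have [c cA' hc] := compact_EVT_min A0 cA (continuous_subspaceT cf).
  exists (f c); first by apply: h => //; exact: classical_sets.set_mem.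
  by move=> a Aa _; apply: hc; exact: classical_sets.mem_set.
have [||mu mu0 hmu] := IH (fun t => Num.max (f t) (- g i t)).
- by move=> x; exact: (@continuous_max R T f (fun t => - g i t) x (cf x) (@continuous_opp
  _ (cg i) x)).
- move=> a Aa hs; rewrite lt_max; have [gi|gi] := leP 0 (g i a).
    by rewrite h // => j; rewrite inE => /orP[/eqP ->|/hs].
  by rewrite oppr_gt0 gi orbT.
(* Halving makes [- g i a < mu] strict, so the maximum can reach [mu] only through [f]. *)
exists (mu / 2); first by rewrite divr_gt0.
have le2 : mu / 2 <= mu by rewrite ler_pdivrMr // ler_peMr ?(ltW mu0) // ler1n.
move=> a Aa hs; have := hmu a Aa; rewrite le_max.
have -> : (mu <= - g i a) = false.
  apply: negbTE; rewrite -ltNge ltrNl; apply: lt_le_trans (hs i (mem_head _ _)).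
  by rewrite ltrN2 ltr_pdivrMr // ltr_pMr // ltr1n.
rewrite orbF => h'; apply: (le_trans le2 (h' _)) => j js.
apply: (@le_trans _ _ (- (mu / 2))); first by rewrite lerN2.
by apply: hs; rewrite inE js orbT.
Qed.

End Margin.

Section PolynomialMatrices.
Variables (R : realType) (n : nat) (V : finType).
Implicit Types (P : V -> V -> {mpoly R[n]}) (x : 'rV[R]_n) (z : V -> R).

Definition eval_matrix P x : V -> V -> R := fun u v => evalx (P u v) x.

Lemma qformZ (C : V -> V -> R) (c : R) z :
  qform C (fun u => c * z u) = c ^+ 2 * qform C z.
Proof.
rewrite /qform mulr_sumr; apply: eq_bigr => u _; rewrite mulr_sumr.
by apply: eq_bigr => v _; ring.
Qed.

(** Compactness is applied to the joint vector of [x] and [z], with [z] on the unit sphere; general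
    [z] follow by scaling. *)
Lemma posdef_margin P (gs : seq {mpoly R[n]}) (r : R) :
  (forall x, (forall g, g \in gs -> 0 <= evalx g x) -> posdef (eval_matrix P x)) ->
  exists2 mu, 0 < mu & forall x, (forall i, `|x ord0 i| <= r) ->
    (forall g, g \in gs -> - mu <= evalx g x) ->
    forall z, mu * (\sum_u z u ^+ 2) <= qform (eval_matrix P x) z.
Proof.
move=> Ppos.
pose T := 'rV[R]_(n + #|V|).
(* Large enough for the coordinates of [x] and for those of a unit vector. *)
pose rho := Num.max r 1.
pose A : set T := fun w => forall i, w ord0 i \in `[- rho, rho].
have cA : compact A by apply: (@rV_compact R _ (fun _ t => t \in `[- rho, rho])) => i;
  exact: segment_compact.
pose xc (i : 'I_n) (w : T) := w ord0 (lshift _ i).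
pose zc (u : V) (w : T) := w ord0 (rshift n (enum_rank u)).
have cxc i : continuous (xc i) by apply: coord_continuous.
have czc u : continuous (zc u) by apply: coord_continuous.
pose X w : 'rV[R]_n := \row_i xc i w.
have evX g w : evalx g (X w) = g.@[fun i => xc i w].
  by apply: meval_eq => i; rewrite mxE.
pose f w := qform (eval_matrix P (X w)) (zc^~ w).
have cf : continuous f.
  apply: continuous_bigsum => u; apply: continuous_bigsum => v.
  rewrite /eval_matrix (_ : (fun t => _) = fun w => (P u v).@[fun i => xc i w] * (zc u w
    * zc v w)).
    by apply: continuous_mul; [exact: continuous_meval|exact: continuous_mul].
  by apply: boolp.funext => w; rewrite evX.
(* [None] and [Some None] are the two inequalities that put [z] on the unit sphere. *)
pose G (o : option (option {mpoly R[n]})) (w : T) :=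
  match o with
  | None => \sum_u zc u w ^+ 2 - 1
  | Some None => 1 - \sum_u zc u w ^+ 2
  | Some (Some g) => evalx g (X w)
  end.
have cs : continuous (fun w => \sum_u zc u w ^+ 2).
  by apply: continuous_bigsum => u; apply: continuous_exp.
have cG o : continuous (G o).
  case: o => [[g|]|] /=.
  - rewrite (_ : G _ = fun w => g.@[fun i => xc i w]); first exact: continuous_meval.
    by apply: boolp.funext => ?; rewrite /G evX.
  - by apply: continuous_add; [move=> w; exact: cst_continuous|exact: continuous_opp].
  - by apply: continuous_add => // w; exact: cst_continuous.
have [|mu mu0 hmu] := @compact_margin R T A _ (None :: Some None :: map (some \o some)
  gs) G f cA cf cG.
  move=> w Aw hG; apply: Ppos.
    move=> g ggs; apply: (hG (Some (Some g))).
    by rewrite !inE /=; apply/mapP; exists g.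
  have := hG None; rewrite mem_head => /(_ isT); rewrite /G subr_ge0 => h1.
  apply: boolp.contrapT => hz; move: h1; rewrite big1 ?ler10 // => u _.
  have [->|zu] := eqVneq (zc u w) 0; first by rewrite expr0n.
  by case: hz; exists u.
exists mu => // x hx hg z.
have [z0|z0] := boolp.pselect (exists u, z u != 0); last first.
  have zE : z = fun=> 0.
    apply: boolp.funext => u; apply/eqP; apply: boolp.contrapT => /negP zu.
    by case: z0; exists u.
  rewrite zE big1 ?mulr0; last by move=> u _; rewrite expr0n.
  by rewrite /qform big1 // => u _; rewrite big1 // => v _; rewrite !mulr0.
set N2 := \sum_u z u ^+ 2.
have N0 : 0 < N2.
  have [u zu] := z0; rewrite /N2 (bigD1 u) //= ltr_pwDl //.
    by rewrite lt_def sqrf_eq0 zu sqr_ge0.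
  by apply: sumr_ge0 => v _; apply: sqr_ge0.
pose c := (Num.sqrt N2)^-1.
have c2 : c ^+ 2 * N2 = 1 by rewrite /c exprVn sqr_sqrtr ?(ltW N0) // mulVf // gt_eqF.
pose w : T := \row_i match split i with inl i => x ord0 i | inr j => c * z (enum_val j) end.
have xw i : xc i w = x ord0 i.
  by rewrite /xc mxE; case: split_ordP => j /eqP;
    rewrite ?eq_lshift ?eq_lrshift // => /eqP ->.
have zw u : zc u w = c * z u.
  rewrite /zc mxE; case: split_ordP => j /eqP; rewrite ?eq_rlshift ?eq_rshift // => /eqP <-.
  by rewrite enum_rankK.
have Xw : X w = x by apply/rowP => i; rewrite mxE xw.
have sw : \sum_u zc u w ^+ 2 = 1.
  by under eq_bigr => u _ do rewrite zw exprMn; rewrite -mulr_sumr.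
have Aw : A w.
  move=> i; rewrite in_itv /= -ler_norml /w mxE le_max; case: split_ordP => j _.
    by rewrite hx.
  apply/orP; right; rewrite -(ler_pXn2r (n := 2)) ?nnegrE // expr1n.
  rewrite real_normK ?num_real // -sw (bigD1 (enum_val j)) //= zw lerDl.
  by apply: sumr_ge0 => v _; apply: sqr_ge0.
have := hmu w Aw; rewrite /f Xw (_ : (zc^~ w) = fun u => c * z u); last first.
  by apply: boolp.funext => u; rewrite zw.
rewrite qformZ => h; rewrite -(ler_pM2l (_ : 0 < c ^+ 2)); last first.
  by rewrite exprn_gt0 // invr_gt0 sqrtr_gt0.
rewrite mulrCA c2 mulr1; apply: h => o;
  rewrite !inE => /or3P[/eqP ->|/eqP ->|/mapP[g ggs ->]] /=.
- by rewrite sw subrr oppr_le0 ltW.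
- by rewrite sw subrr oppr_le0 ltW.
- by rewrite Xw; apply: hg.
Qed.

End PolynomialMatrices.

(** * Positive definite polynomial matrices *)

Section Decomposition.
Variables (R : realType) (n : nat).
Implicit Types (p : {mpoly R[n]}) (M : {mpoly R[n]} -> Prop) (x : 'rV[R]_n).

Lemma evalx_bounded p (r : R) :
  exists2 B, 0 <= B & forall x, (forall i, `|x ord0 i| <= r) -> `|evalx p x| <= B.
Proof.
exists (\sum_(a <- msupp p) `|p@_a| * \prod_i `|r| ^+ a i).
  by apply: sumr_ge0 => a _; rewrite mulr_ge0 // prodr_ge0 // => i _; rewrite exprn_ge0.
move=> x hx; rewrite /evalx mevalE; apply: le_trans (ler_norm_sum _ _ _) _.
apply: ler_sum => a _; rewrite normrM ler_wpM2l // normr_prod.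
apply: ler_prod => i _; rewrite normr_ge0 normrX lerXn2r ?nnegrE //.
by apply: le_trans (hx i) _; apply: ler_norm.
Qed.

(** Adding the squares of the other variables bounds each ['X_i ^+ 2] by [rho1] in [M]. Rescaling by
    a large [r] then brings this bound below the threshold of [qm_prod_1subsq]. *)
Lemma qm_box M (rho : R) : quadmod M -> M (rho%:MP - sqnorm_x) ->
  exists2 r : R, 0 < r & forall s : seq 'I_n, uniq s ->
    M (\prod_(i <- s) (1 - (r^-1 *: 'X_i) ^+ 2)).
Proof.
move=> qM Mrho; pose rho1 := Num.max rho 1.
have rho1_ge1 : 1 <= rho1 by rewrite le_max lexx orbT.
have M1 i : M (rho1%:A - 'X_i ^+ 2).
  have -> : rho1%:A - 'X_i ^+ 2 = (rho%:MP - sqnorm_x) +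
      ((rho1 - rho)%:A + \sum_(j < n | j != i) 'X_j ^+ 2) :> {mpoly R[n]}.
    rewrite /sqnorm_x [\sum_(j < n) _](bigD1 i) //= scalerBl -!mul_mpolyC !mulr1.
    by ring.
  apply: (qmD qM) => //; apply: (qmD qM).
    by apply: (qmC qM); rewrite subr_ge0 le_max lexx.
  by apply: (qm_sum qM) => j _; apply: (qm_sq qM).
have two1 : 1 <= 2 ^+ n :> R by rewrite exprn_ege1 // ler1n.
have rho_gt0 : 0 < rho1 by apply: lt_le_trans rho1_ge1.
(* Then [rho1 / r ^+ 2] is at most [2 ^- n], because [r >= 1]. *)
pose r := rho1 * 2 ^+ n.
have r1 : 1 <= r by apply: mulr_ege1.
have r0 : 0 < r by apply: lt_le_trans r1.
exists r => //; apply: (@qm_prod_1subsq _ _ _ qM n (r^-1 ^+ 2 * rho1)).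
- by rewrite mulr_ge0 ?sqr_ge0 // ltW.
- rewrite exprVn -ler_pdivlMr // mulrC -invfM lef_pV2 ?posrE ?mulr_gt0 ?exprn_gt0 //.
  by rewrite expr2 -/r ler_peMl // ltW.
- move=> i; rewrite exprZn -scalerA -scalerBr; apply: (qmZ qM) => //.
  by rewrite sqr_ge0.
Qed.

(** For [s > 0], Bernoulli's inequality bounds [(1 + s) ^+ K] below by [1 + s *+ K], while
    [(1 - s) ^+ K * (1 + s) ^+ K <= 1]. For [s <= 0] the left side is not positive. *)
Lemma mul_pow_le (s : R) K : s <= 1 -> (0 < K)%N -> s * (1 - s) ^+ K <= K%:R^-1.
Proof.
move=> s1 K0; have K0' : 0 < K%:R :> R by rewrite ltr0n.
have [s0|s0] := leP s 0.
  apply: (@le_trans _ _ 0); last by rewrite invr_ge0 ltW.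
  by rewrite mulr_le0_ge0 // exprn_ge0 // subr_ge0.
have h : (1 - s) ^+ K * (1 + s *+ K) <= 1.
  have b : 1 + s *+ K <= (1 + s) ^+ K.
    elim: (K) => [|k IH]; first by rewrite addr0 expr0.
    rewrite exprS mulrS; apply: le_trans (ler_wpM2l _ IH); last by lra.
    rewrite mulrDl mul1r mulrDr mulr1 addrA -[leLHS]addr0 addrACA.
    have : 0 <= s * (s *+ k) by rewrite mulr_ge0 ?mulrn_wge0 // ltW.
    lra.
  apply: le_trans (ler_wpM2l _ b) _; first by rewrite exprn_ge0 // subr_ge0.
  rewrite -exprMn exprn_ile1 //.
    by rewrite mulr_ge0 // ?subr_ge0 // addr_ge0 // ltW.
  by have := sqr_ge0 s; rewrite expr2; lra.
have pK : 0 <= (1 - s) ^+ K by rewrite exprn_ge0 // subr_ge0.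
rewrite -[K%:R^-1]mul1r ler_pdivlMr //.
by move: h; rewrite mulrDr mulr1 -[s *+ K]mulr_natr mulrA [_ * s]mulrC; lra.
Qed.

Variables (V : finType) (e : rel V).
Implicit Types (P : V -> V -> {mpoly R[n]}) (C D : V -> V -> R) (z : V -> R).

(** Constant matrices can be factored one by one, and a linear operation on polynomials acts on the
    weights [b i] alone. *)
Definition sos_decomposition M P : Prop :=
  exists (I : finType) (b : I -> {mpoly R[n]}) (C : I -> V -> V -> R),
    [/\ forall i, M (b i), forall i, symm (C i), forall i, sparse e (C i),
        forall i, posdef (C i) &
        forall u v, P u v = \sum_i C i u v *: b i].

Definition sqn z : R := \sum_u z u ^+ 2.

Lemma sqn_ge0 z : 0 <= sqn z.
Proof. by apply: sumr_ge0 => u _; apply: sqr_ge0. Qed.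

Lemma sqn_gt0 z u : z u != 0 -> 0 < sqn z.
Proof.
move=> zu; rewrite /sqn (bigD1 u) //= ltr_pwDl //.
  by rewrite lt_def sqrf_eq0 zu sqr_ge0.
by apply: sumr_ge0 => v _; apply: sqr_ge0.
Qed.

Lemma abs_mul_le_sqn z u v : `|z u * z v| <= sqn z.
Proof.
have hz w : `|z w| ^+ 2 <= sqn z.
  rewrite real_normK ?num_real // /sqn (bigD1 w) //= lerDl.
  by apply: sumr_ge0 => ? _; apply: sqr_ge0.
have := sqr_ge0 (`|z u| - `|z v|); rewrite sqrrB normrM.
by have := hz u; have := hz v; rewrite mulr2n; lra.
Qed.

Lemma qform_diag (c : R) z : qform (fun u v => c *+ (u == v)) z = c * sqn z.
Proof.
rewrite /qform /sqn mulr_sumr; apply: eq_bigr => u _.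
rewrite (bigD1 u) //= eqxx big1 ?addr0 ?expr2 // => v; rewrite eq_sym => /negPf ->.
by rewrite mul0r.
Qed.

Lemma qform_dist C D (eta : R) z :
  (forall u v, `|C u v - D u v| <= eta) ->
  qform D z - (#|V| ^ 2)%:R * eta * sqn z <= qform C z.
Proof.
move=> h; rewrite lerBlDl -lerBlDr -qformB.
apply: le_trans (ler_norm _) _; apply: le_trans (ler_norm_sum _ _ _) _.
apply: (@le_trans _ _ (\sum_(u : V) \sum_(v : V) eta * sqn z)).
  apply: ler_sum => u _; apply: le_trans (ler_norm_sum _ _ _) _.
  apply: ler_sum => v _; rewrite normrM ler_pM ?abs_mul_le_sqn //.
  by rewrite distrC.
by rewrite !sumr_const -mulrnA -[leLHS]mulr_natl mulrA.
Qed.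

Lemma qform_lower C (B : R) z :
  (forall u v, `|C u v| <= B) -> - ((#|V| ^ 2)%:R * B * sqn z) <= qform C z.
Proof.
move=> h; have := @qform_dist C (fun _ _ => 0) B z _.
rewrite {1}/qform big1 ?sub0r; last by move=> u _; rewrite big1 // => v _; rewrite mul0r.
by apply => u v; rewrite subr0.
Qed.

(* Where some [g j] is negative its penalty term is large; elsewhere [mul_pow_le]
   makes the total penalty small, and [P] is already positive definite. *)
Lemma penalty_positive (J : finType) (g : J -> {mpoly R[n]}) P (r : R) :
  (forall x, (forall j, 0 <= evalx (g j) x) -> posdef (eval_matrix P x)) ->
  exists lam del G (k : nat), [/\ 0 < lam, 0 < del, 0 < G &
    forall x, (forall i, `|x ord0 i| <= r) -> forall z,
    del * sqn z <= qform (eval_matrix (fun u v => P u v -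
      (lam *: \sum_j g j * (1 - G^-1 *: g j) ^+ k.*2) *+ (u == v)) x) z].
Proof.
move=> Ppos.
have [|mu mu0 hmu] := @posdef_margin _ _ _ P (codom g) r.
  by move=> x hx; apply: Ppos => j; apply: hx; apply: codom_f.
have [B B0 hB] : exists2 B, 0 <= B & forall u v x, (forall i, `|x ord0 i| <= r) ->
  `|evalx (P u v) x| <= B.
  have /fin_all_exists2[B B0 hB] u : exists2 B, 0 <= B & forall v x, (forall i, `|x ord0
    i| <= r) -> `|evalx (P u v) x| <= B.
    have /fin_all_exists2[B B0 hB] v := evalx_bounded (P u v) r.
    exists (\sum_v B v); first by apply: sumr_ge0.
    move=> v x hx; rewrite (bigD1 v) //= (le_trans (hB v x hx)) // lerDl.
    by apply: sumr_ge0.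
  exists (\sum_v B v); first by apply: sumr_ge0.
  move=> u v x hx; rewrite (bigD1 u) //= (le_trans (hB u v x hx)) // lerDl.
  by apply: sumr_ge0.
have [G G0 hG] : exists2 G, 0 < G & forall j x, (forall i, `|x ord0 i| <= r) -> evalx (g
  j) x <= G.
  have /fin_all_exists2[G G0 hG] j := evalx_bounded (g j) r.
  exists (1 + \sum_j G j); first by rewrite ltr_pwDl // sumr_ge0.
  move=> j x hx; rewrite (le_trans (ler_norm _)) // (le_trans (hG j x hx)) //.
  rewrite (bigD1 j) //=; have : 0 <= \sum_(i | i != j) G i by apply: sumr_ge0.
  by lra.
pose B' := (#|V| ^ 2)%:R * B.
have B'0 : 0 <= B' by rewrite mulr_ge0.
(* [lam * mu = B' + mu]: one constraint violated by [mu] outweighs the worst value [- B'] of the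
   form of [P] on unit vectors, with [mu] to spare. *)
pose lam := (B' + mu) / mu.
have lam0 : 0 < lam by rewrite divr_gt0 // ltr_wpDl.
have [k0 hk0] := ultimately_natr (lam * #|J|%:R * G / (mu / 2)).
(* [k0] keeps the total of the positive penalties below [mu / 2]; the maximum with 1 makes the
   exponent positive, as [mul_pow_le] requires. *)
pose k := maxn k0 1; have k1 : (0 < k.*2)%N by rewrite /k; lia.
have hk : lam * (#|J|%:R * (G / k.*2%:R)) <= mu / 2.
  have K0 : 0 < k.*2%:R :> R by rewrite ltr0n.
  have := hk0 k.*2 (leq_trans (leq_maxl _ 1) (_ : k <= k.*2)%N).
  rewrite ler_pdivrMr ?divr_gt0 // => h.
  by rewrite !mulrA ler_pdivrMr // [leRHS]mulrC; apply: h; lia.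
exists lam, (mu / 2), G, k; split => //; first by rewrite divr_gt0.
move=> x hx z.
pose h j : R := evalx (g j) x * (1 - G^-1 * evalx (g j) x) ^+ k.*2.
have -> : qform (eval_matrix (fun u v => P u v -
      (lam *: \sum_j g j * (1 - G^-1 *: g j) ^+ k.*2) *+ (u == v)) x) z =
    qform (eval_matrix P x) z - lam * (\sum_j h j) * sqn z.
  rewrite -qform_diag -qformB; apply: eq_bigr => u _; apply: eq_bigr => v _.
  congr (_ * _); rewrite /eval_matrix /evalx mevalB mevalMn mevalZ raddf_sum /=.
  congr (_ - _ * _ *+ _); apply: eq_bigr => j _.
  by rewrite mevalM rmorphXn /= mevalB meval1 mevalZ.
have hle j : h j <= G / k.*2%:R.
  have sj : G^-1 * evalx (g j) x <= 1 by rewrite mulrC ler_pdivrMr // mul1r hG.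
  have := mul_pow_le sj k1.
  by rewrite -(ler_pM2l G0) !mulrA divff ?gt_eqF // mul1r.
have GK : 0 <= G / k.*2%:R by rewrite divr_ge0 // ltW.
have S0 := sqn_ge0 z.
rewrite lerBrDr -mulrDl.
have sumh (Q : pred J) : \sum_(j | Q j) h j <= #|J|%:R * (G / k.*2%:R).
  apply: (@le_trans _ _ (\sum_(j | Q j) G / k.*2%:R)); first exact: ler_sum.
  rewrite sumr_const -[leLHS]mulr_natl ler_wpM2r // ler_nat.
  exact: max_card.
have [hg|/boolp.existsNP[j hg]] := boolp.pselect (forall j, - mu <= evalx (g j) x).
  have hP : mu * sqn z <= qform (eval_matrix P x) z.
    by apply: (hmu x hx) => p /codomP[j ->].
  apply: le_trans hP; rewrite ler_wpM2r //.
  by have := le_trans (ler_wpM2l (ltW lam0) (sumh predT)) hk; lra.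
move/negP: hg; rewrite -ltNge => hg.
have gj : evalx (g j) x <= - mu by apply: ltW.
have hj : h j <= - mu.
  have h1 : 1 <= (1 - G^-1 * evalx (g j) x) ^+ k.*2.
    rewrite exprn_ege1 // lerDl oppr_ge0 mulr_ge0_le0 ?invr_ge0 ?(ltW G0) //.
    by rewrite (le_trans gj) // oppr_le0 ltW.
  by rewrite /h (le_trans _ gj) // ler_neMr // ltW // (lt_trans hg) // oppr_lt0.
apply: le_trans (qform_lower z (fun u v => hB u v x hx)).
rewrite -/B' -mulNr ler_wpM2r // (bigD1 j) //= mulrDr.
have h2 := le_trans (ler_wpM2l (ltW lam0) (sumh (fun i => i != j))) hk.
have h3 := ler_wpM2l (ltW lam0) hj.
have h4 : lam * mu = B' + mu by rewrite /lam mulfVK // gt_eqF.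
rewrite mulrN h4 in h3; lra.
Qed.

(** The pattern of [P] survives because a zero entry has only zero Bernstein coefficients and the
    penalties are diagonal. The even exponent makes each penalty a square times [g j], hence an
    element of [M]. *)
Lemma archimedean_sos_decomposition M (rho : R) (J : finType) (g : J -> {mpoly R[n]}) P :
  quadmod M -> M (rho%:MP - sqnorm_x) -> (forall j, M (g j)) ->
  symm P -> sparse e P ->
  (forall x, (forall j, 0 <= evalx (g j) x) -> posdef (eval_matrix P x)) ->
  sos_decomposition M P.
Proof.
move=> qM Mrho Mg Psym Psp Ppos.
have [r r0 hr] := qm_box qM Mrho.
have [lam [del [G [k [lam0 del0 G0 hP]]]]] := penalty_positive r Ppos.
pose pen j := g j * (1 - G^-1 *: g j) ^+ k.*2.
pose P' u v := P u v - (lam *: \sum_j pen j) *+ (u == v).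
have P'sym : symm P' by move=> u v; rewrite /P' Psym eq_sym.
have P'sp : sparse e P'.
  by move=> u v uv euv; rewrite /P' Psp // (negPf uv) subr0.
(* An error of [eta] in every entry costs the form at most [#|V| ^ 2 * eta] times the squared norm;
   the added 1 keeps this strictly below [del]. *)
pose eta := del / ((#|V| ^ 2)%:R + 1).
have V0 : 0 <= (#|V| ^ 2)%:R :> R by rewrite ler0n.
have eta0 : 0 < eta by rewrite divr_gt0 // ltr_wpDl.
have [N hN] : exists N, forall u v,
    P' u v = \sum_k bernstein_coef r (P' u v) k *: @bernstein_basis R n r N k /\
    forall k : {ffun 'I_n -> 'I_N.+1},
      `|bernstein_coef r (P' u v) k - evalx (P' u v) (grid_point r k)| <= eta.
  have [|N0 hN0] := @ultimately_fin V (fun u N => forall v,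
      P' u v = \sum_k bernstein_coef r (P' u v) k *: @bernstein_basis R n r N k /\
    forall k : {ffun 'I_n -> 'I_N.+1},
      `|bernstein_coef r (P' u v) k - evalx (P' u v) (grid_point r k)| <= eta).
    move=> u; apply: ultimately_fin => v; apply: ultimately_imp2.
    - by move=> N h1 h2; split; [exact: h1|exact: h2].
    - by apply: bernstein_expansion; rewrite gt_eqF.
    - exact: bernstein_coef_close.
  by exists N0 => u v; apply: hN0.
pose I := ({ffun 'I_n -> 'I_N.+1} + J)%type.
exists I, (fun i => match i with inl k => bernstein_basis r k | inr j => pen j end),
  (fun i u v => match i with inl k => bernstein_coef r (P' u v) k | inr j => lam *+ (u ==
    v) end).
split.
- case=> [a|j]; first exact: qm_bernstein_basis.
  by rewrite /pen mulrC -muln2 exprM; apply: (qm_sqM qM).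
- by case=> [a|j] u v; [rewrite P'sym|rewrite eq_sym].
- case=> [a|j] u v uv euv; last by rewrite (negPf uv).
  by rewrite P'sp // /bernstein_coef /to_ucoord comp_mpoly0 msupp0 big_nil.
- case=> [a|j] z [u zu]; last by rewrite qform_diag mulr_gt0 // (sqn_gt0 zu).
  have hx i : `|grid_point r a ord0 i| <= r.
    rewrite mxE; have := @ratio_bounds R (a i) N; rewrite -ltnS ltn_ord => /(_ isT).
    move=> /andP[t0 t1]; set t := _ / _ in t0 t1 *.
    rewrite ler_norml mulr2n; have := mulr_ge0 (ltW r0) t0.
    by have := ler_wpM2l (ltW r0) t1; rewrite mulr1 mulrDl; lra.
  have h1 := hP _ hx z.
  have h2 := @qform_dist (fun u v => bernstein_coef r (P' u v) a)
     (eval_matrix P' (grid_point r a)) eta z (fun u v => (hN u v).2 a).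
  apply: lt_le_trans h2; rewrite subr_gt0; apply: lt_le_trans h1.
  rewrite ltr_pM2r ?(sqn_gt0 zu) // /eta mulrCA gtr_pMr // ltr_pdivrMr ?ltr_wpDl //.
  by rewrite mul1r ltrDl.
- move=> u v; rewrite big_sumType /= -(hN u v).1 -scaler_sumr /P'.
  by case: (u == v); rewrite ?mulr1n ?subrK // !mulr0n subr0 scale0r addr0.
Qed.

End Decomposition.

(** * Homogenization *)

Definition quadratic_module (A : pzRingType) (q : nat) (g : 'I_q -> A) (f : A) : Prop :=
  exists (s0 : A) (s : 'I_q -> A),
    [/\ sos s0, forall j, sos (s j) & f = s0 + \sum_j g j * s j].

Section GeneratedQuadraticModule.
Variables (A : comPzRingType) (q : nat) (g : 'I_q -> A).

Lemma sosD (a b : A) : sos a -> sos b -> sos (a + b).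
Proof. by move=> [s ->] [t ->]; exists (s ++ t); rewrite big_cat. Qed.

Lemma sos_sq (a : A) : sos (a ^+ 2).
Proof. by exists [:: a]; rewrite big_seq1. Qed.

Lemma sos0 : sos (0 : A).
Proof. by exists [::]; rewrite big_nil. Qed.

Lemma sos_sum (I : Type) (r : seq I) (F : I -> A) :
  (forall i, sos (F i)) -> sos (\sum_(i <- r) F i).
Proof.
move=> h; elim/big_rec: _ => [|i a _ ha]; first exact: sos0.
exact: sosD.
Qed.

Lemma sosM (a b : A) : sos a -> sos b -> sos (a * b).
Proof.
move=> [s ->] [t ->]; rewrite mulr_suml; apply: sos_sum => x.
rewrite mulr_sumr; apply: sos_sum => y.
by rewrite -exprMn; apply: sos_sq.
Qed.

Lemma sos_exp (a : A) k : sos a -> sos (a ^+ k).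
Proof.
move=> sa; elim: k => [|k IH]; last by rewrite exprS; apply: sosM.
by rewrite expr0 -(expr1n A 2); apply: sos_sq.
Qed.

Lemma quadratic_moduleP : quadmod (quadratic_module g).
Proof.
split.
- exists 1, (fun=> 0); split=> [||]; last by rewrite big1 ?addr0 // => j _; rewrite mulr0.
    by rewrite -(expr1n A 2); apply: sos_sq.
  by move=> _; apply: sos0.
- move=> _ _ [s0 [s [hs0 hs ->]]] [t0 [t [ht0 ht ->]]].
  exists (s0 + t0), (fun j => s j + t j); split=> [|j|]; try exact: sosD.
  by under [in RHS]eq_bigr do rewrite mulrDr; rewrite big_split /=; ring.
- move=> a _ [s0 [s [hs0 hs ->]]].
  exists (a ^+ 2 * s0), (fun j => a ^+ 2 * s j); split=> [|j|].
  + by apply: sosM => //; apply: sos_sq.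
  + by apply: sosM => //; apply: sos_sq.
  + rewrite mulrDr mulr_sumr; congr (_ + _); apply: eq_bigr => j _.
    by rewrite mulrCA.
Qed.

Lemma quadratic_module_gen j : quadratic_module g (g j).
Proof.
exists 0, (fun i => (i == j)%:R); split; first exact: sos0.
  by move=> i; case: eqP => _; [rewrite -(expr1n A 2); apply: sos_sq|apply: sos0].
rewrite add0r (bigD1 j) //= eqxx mulr1 big1 ?addr0 // => i /negPf ->.
by rewrite mulr0.
Qed.

Lemma quadratic_module_ind (Q : A -> Prop) (f : A) :
  Q 0 -> (forall a b, Q a -> Q b -> Q (a + b)) -> (forall a, Q (a ^+ 2)) ->
  (forall j a, Q (g j * a ^+ 2)) -> quadratic_module g f -> Q f.
Proof.
move=> Q0 QD Qsq Qg [s0 [s [[t0 ->] hs ->]]]; apply: (QD).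
  by elim/big_rec: _ => // i a _ ha; exact: QD.
elim/big_rec: _ => // j a _ ha; apply: (QD) => //; have [t ->] := hs j.
by rewrite mulr_sumr; elim/big_rec: _ => // i b _ hb; exact: QD.
Qed.

End GeneratedQuadraticModule.

Section Homogenization.
Variables (R : realType) (n : nat) (N : {mpoly R[n]}).
Hypothesis Nhom : N \is 2.-homog.
Implicit Types (f a : {mpoly R[n]}) (d h : nat).

(* The components of odd degree of [f] are lost; for [N] of degree 2 the result
   is homogeneous of degree [2 h]. *)
Definition homogenize h f : {mpoly R[n]} :=
  \sum_(i < h.+1) pihomog mdeg i.*2 f * N ^+ (h - i).

Lemma homogenize_sum h (I : Type) (s : seq I) (Q : pred I) (F : I -> {mpoly R[n]}) :
  homogenize h (\sum_(i <- s | Q i) F i) = \sum_(i <- s | Q i) homogenize h (F i).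
Proof.
rewrite /homogenize exchange_big /=; apply: eq_bigr => i _.
by rewrite raddf_sum /= mulr_suml.
Qed.

Lemma homogenizeD h f a : homogenize h (f + a) = homogenize h f + homogenize h a.
Proof.
rewrite /homogenize -big_split /=; apply: eq_bigr => i _.
by rewrite raddfD /= mulrDl.
Qed.

Lemma homogenizeB h f a : homogenize h (f - a) = homogenize h f - homogenize h a.
Proof.
rewrite /homogenize -sumrB; apply: eq_bigr => i _.
by rewrite raddfB /= mulrBl.
Qed.

Lemma homogenizeZ h (c : R) f : homogenize h (c *: f) = c *: homogenize h f.
Proof.
rewrite /homogenize scaler_sumr; apply: eq_bigr => i _.
by rewrite linearZ /= scalerAl.
Qed.

Lemma homogenize_homog h d f : f \is d.-homog ->
  homogenize h f = if odd d || (h < d./2)%N then 0 else f * N ^+ (h - d./2).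
Proof.
move=> fd; have [dh|dh] := boolP (odd d || (h < d./2)%N).
  rewrite /homogenize big1 // => i _.
  rewrite (@pihomog_ne0 _ _ _ d) ?mul0r //.
  by apply: contraTneq dh => ->; rewrite odd_double doubleK /= -leqNgt -ltnS.
move: dh; rewrite negb_or -leqNgt => /andP[dodd dh].
have lt_dh : (d./2 < h.+1)%N by [].
rewrite /homogenize (bigD1 (Ordinal lt_dh)) //= even_halfK // pihomog_dE //.
rewrite big1 ?addr0 // => i ine; rewrite (@pihomog_ne0 _ _ _ d) ?mul0r //.
apply: contra ine => /eqP dE; apply/eqP/val_inj => /=.
by rewrite dE doubleK.
Qed.

Lemma homog_components a :
  exists L, a = \sum_(d < L) pihomog mdeg d a.
Proof. by exists (mmeasure mdeg a); apply: pihomog_partitionE. Qed.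

(* [a0] and [a1] are homogenizations of the even and of the odd part of [a]. *)
Lemma homogenize_sq a : exists D a0 a1, forall h, (D.*2 < h)%N ->
  homogenize h (a ^+ 2) = N ^+ (h - D.*2) * a0 ^+ 2 + N ^+ (h - D.*2.+1) * a1 ^+ 2.
Proof.
have [D aE] := homog_components a.
pose c d := pihomog mdeg d a.
have chom d : c d \is d.-homog by apply: pihomogP.
(* Powers of [N] pad all components of parity [b] to degree [D.*2 + b]. A product of components of
   opposite parity has odd degree and is lost in [homogenize]. *)
pose part (b : bool) := \sum_(d < D | odd d == b) c d * N ^+ (D - d./2).
exists D, (part false), (part true) => h Dh.
have partE (b : bool) : N ^+ (h - D.*2 - b) * part b ^+ 2 =
    \sum_(d < D | odd d == b) \sum_(d' < D) homogenize h (c d * c d').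
  rewrite expr2 /part mulr_suml mulr_sumr; apply: eq_bigr => d /eqP db.
  rewrite mulrA mulr_sumr big_mkcond /=; apply: eq_bigr => d' _.
  rewrite (homogenize_homog h (dhomogM (chom d) (chom d'))) oddD db.
  have hd := ltn_ord d; have hd' := ltn_ord d'.
  case: eqP => [db'|/eqP db']; last by case: b db db' => _; case: (odd d').
  rewrite db' addbb /= ltnNge (_ : ((d + d')./2 <= h)%N) /=; last by lia.
  have -> : (h - (d + d')./2 = (h - D.*2 - b) + (D - d./2) + (D - d'./2))%N.
    by rewrite halfD db db' andbb; case: (b); lia.
  by rewrite !exprD; ring.
have := partE true; have := partE false; rewrite subn0 -subnDA addn1 => -> ->.
have -> : a ^+ 2 = (\sum_(d < D) c d) * (\sum_(d < D) c d) by rewrite -aE expr2.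
rewrite mulr_suml homogenize_sum (bigID (fun d : 'I_D => odd d)) /= addrC.
by congr (_ + _); apply: eq_big => [d|d _];
  rewrite ?eqb_id ?eqbF_neg // mulr_sumr homogenize_sum.
Qed.

(** Extracting [g] takes up degree [e.*2] of the target degree, hence [h - e]. *)
Lemma homogenize_mul g f : forall e h, g \is (e.*2).-homog -> (e <= h)%N ->
  homogenize h (g * f) = g * homogenize (h - e) f.
Proof.
move=> e h ge eh; have [D ->] := homog_components f.
rewrite mulr_sumr !homogenize_sum mulr_sumr; apply: eq_bigr => d _.
have fd := @pihomogP _ _ mdeg d f.
rewrite (homogenize_homog h (dhomogM ge fd)) (homogenize_homog (h - e) fd).
rewrite oddD odd_double /= halfD odd_double doubleK /= add0n.
rewrite ltnNge [(h - e < _)%N]ltnNge leq_subRL // -!ltnNge.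
case: (_ || _); first by rewrite mulr0.
by rewrite mulrA; congr (_ * _ * _); congr (_ ^+ _); lia.
Qed.

(** A component and its product with [N] have the same homogenization, once [h] is large enough for
    both to be kept. *)
Lemma homogenize_ideal f : ultimately (fun h => homogenize h ((1 - N) * f) = 0).
Proof.
have [D ->] := homog_components f; exists D.+1 => h Dh.
rewrite mulr_sumr homogenize_sum big1 // => d _.
have fd := @pihomogP _ _ mdeg d f; have hd := ltn_ord d.
rewrite mulrBl mul1r homogenizeB (homogenize_homog h (dhomogM Nhom fd)).
rewrite (homogenize_homog h fd) oddD [odd 2]/= addFb.
have [//|_] := boolP (odd d); first by rewrite subrr.
have -> : (h < d./2)%N = false by lia.
have -> : (h < (2 + d)./2)%N = false by lia.
rewrite /=.
rewrite [N * _]mulrC -mulrA -exprS; apply/eqP; rewrite subr_eq0; apply/eqP.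
by congr (_ * _ ^+ _); lia.
Qed.

Variables (q : nat) (g : 'I_q -> {mpoly R[n]}).
Hypotheses (Nsos : sos N) (geven : forall j, even_homog (g j)).

(** It suffices to treat squares and their products with a [g j]. The even degree of [g j] lets it
    be factored out, and the powers of [N] that appear are sums of squares. *)
Lemma homogenize_quadratic_module f : quadratic_module g f ->
  ultimately (fun h => quadratic_module g (homogenize h f)).
Proof.
have qM := quadratic_moduleP g.
have step a b : quadratic_module g b ->
    ultimately (fun h => quadratic_module g (b * homogenize h (a ^+ 2))).
  move=> qb; have [D [a0 [a1 hD]]] := homogenize_sq a.
  exists D.*2.+1 => h Dh; rewrite hD // mulrDr.
  by apply: (qmD qM); rewrite mulrC -mulrA; apply: (qm_sosM qM (sos_exp _ Nsos));
    apply: (qm_sqM qM).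
apply: (@quadratic_module_ind _ _ g (fun f => ultimately (fun h => quadratic_module g
  (homogenize h f)))).
- apply: ultimatelyT => h; rewrite /homogenize big1 => [|i _]; last by rewrite raddf0 mul0r.
  exact: (qm0 qM).
- move=> a b; apply: ultimately_imp2 => h; rewrite homogenizeD; exact: (qmD qM).
- by move=> a; apply: ultimately_imp (step a _ (qm1 qM)) => h; rewrite mul1r.
- move=> j a; have [k kodd gk] := geven j.
  have [h0 hh0] := step a _ (quadratic_module_gen g j).
  exists (h0 + k./2)%N => h hh; rewrite (@homogenize_mul _ _ k./2) ?even_halfK //;
    last by lia.
  by apply: hh0; lia.
Qed.

(** Allows arithmetic modulo the equation [N = 1] of the unit sphere. *)
Definition add_ideal (M : {mpoly R[n]} -> Prop) f : Prop :=
  exists f0 a, M f0 /\ f = f0 + (1 - N) * a.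

Lemma add_idealP M : quadmod M -> quadmod (add_ideal M).
Proof.
move=> qM; split.
- by exists 1, 0; split; [exact: (qm1 qM)|rewrite mulr0 addr0].
- move=> _ _ [f [a [Mf ->]]] [f' [a' [Mf' ->]]].
  by exists (f + f'), (a + a'); split; [exact: (qmD qM)|ring].
- move=> b _ [f [a [Mf ->]]]; exists (b ^+ 2 * f), (b ^+ 2 * a).
  by split; [exact: (qm_sqM qM)|ring].
Qed.

(** Homogenization is linear and leaves the constant matrices [C i] alone; on the entries of [P],
    all of degree [k], it is multiplication by [N ^+ (h - k./2)]. *)
Lemma sos_decomposition_homog (V : finType) (e : rel V) (P : V -> V -> {mpoly R[n]}) k :
  ~~ odd k -> (forall u v, P u v \is k.-homog) ->
  sos_decomposition e (add_ideal (quadratic_module g)) P ->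
  exists nu, sos_decomposition e (quadratic_module g) (fun u v => N ^+ nu * P u v).
Proof.
move=> kodd Pk [I [b [C [hb Csym Csp Cpos PE]]]].
have [h0 hh0] : ultimately (fun h => forall i, quadratic_module g (homogenize h (b i))).
  apply: ultimately_fin => i; have [f [a [Mf ->]]] := hb i.
  apply: ultimately_imp2 (homogenize_quadratic_module Mf) (homogenize_ideal a) => h h1 h2.
  by rewrite homogenizeD h2 addr0.
pose h := (h0 + k./2)%N; exists (h - k./2)%N, I, (fun i => homogenize h (b i)), C.
split=> // [i|u v]; first by apply: hh0; rewrite leq_addr.
have := congr1 (homogenize h) (PE u v);
  rewrite homogenize_sum (homogenize_homog h (Pk u v)).
rewrite (negPf kodd) ltnNge leq_addl /= mulrC => ->.
by apply: eq_bigr => i _; rewrite homogenizeZ.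
Qed.

End Homogenization.

(** * Gram matrices *)

Lemma mdegS_split (m k : nat) (b : 'X_{1..m}) :
  mdeg b = k.+1 -> exists i (b' : 'X_{1..m}), b = (U_(i) + b')%MM /\ mdeg b' = k.
Proof.
move=> bk; have [i bi|b0] := pickP (fun i => b i != 0%N); last first.
  move: bk; rewrite mdegE big1 // => i _; apply/eqP.
  by have := b0 i => /negbFE.
have le_ib : (U_(i) <= b)%MM by rewrite lep1mP.
exists i, (b - U_(i))%MM; split; first by rewrite addmC submK.
by have := congr1 mdeg (submK le_ib); rewrite mdegD mdeg1 bk addn1 => -[].
Qed.

Section GramMatrix.
Variables (R : realType) (n m : nat).
Implicit Types (f p : xypoly R n m) (x : 'rV[R]_n) (y : 'rV[R]_m).

Lemma evalxyZX (c : {mpoly R[n]}) (b : 'X_{1..m}) x y :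
  evalxy (c *: 'X_[b]) x y = evalx c x * 'X_[b].@[y ord0].
Proof.
rewrite /evalxy /evalx mevalZ mevalM; congr (_ * _).
rewrite !mevalX rmorph_prod; apply: eq_bigr => i _.
by rewrite rmorphXn /= mevalC.
Qed.

Lemma evalxy_sum (I : Type) (s : seq I) (Q : pred I) (F : I -> xypoly R n m) x y :
  evalxy (\sum_(i <- s | Q i) F i) x y = \sum_(i <- s | Q i) evalxy (F i) x y.
Proof.
apply: (big_morph (fun f => evalxy f x y)) => [f g|];
  last by rewrite /evalxy /evalx !meval0.
by rewrite /evalxy /evalx !mevalD.
Qed.

Section Gram.
Variables (V : finType) (e : rel V) (mon : V -> 'X_{1..m}).
Hypothesis esym : symmetric e.
Implicit Types (P : V -> V -> {mpoly R[n]}).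

Definition gram P : xypoly R n m := \sum_u \sum_v P u v *: 'X_[mon u + mon v].

Lemma evalxy_gram P x y :
  evalxy (gram P) x y = qform (eval_matrix P x) (fun u => 'X_[mon u].@[y ord0]).
Proof.
rewrite /gram evalxy_sum; apply: eq_bigr => u _.
rewrite evalxy_sum; apply: eq_bigr => v _.
by rewrite evalxyZX mpolyXD mevalM.
Qed.

(** For each monomial one splitting [mon s + mon t] is chosen, and half of its coefficient goes to
    each of the entries [(s, t)] and [(t, s)]. *)
Lemma gram_matrix f :
  (forall b, b \in msupp f -> exists s t, b = (mon s + mon t)%MM /\ (s != t -> e s t)) ->
  exists P, [/\ symm P, sparse e P, f = gram P &
    forall k, (forall b, f@_b \is k.-homog) -> forall u v, P u v \is k.-homog].
Proof.
move=> hf.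
suff [P [h1 h2 h3 h4]] : exists P, [/\ symm P, sparse e P,
    \sum_(b <- msupp f) f@_b *: 'X_[b] = gram P &
    forall k, (forall b, f@_b \is k.-homog) -> forall u v, P u v \is k.-homog].
  by exists P; split; rewrite // [LHS]mpolyE.
rewrite big_seq; elim/big_rec: _ => [|b f' bf [P [h1 h2 h3 h4]]].
  exists (fun _ _ => 0); split=> // [|k _ u v]; last exact: dhomog0.
  by rewrite /gram big1 // => u _; rewrite big1 // => v _; rewrite scale0r.
have [s [t [bE est]]] := hf b bf.
pose c : {mpoly R[n]} := 2^-1 *: f@_b.
(* When [s = t] both halves fall on the same diagonal entry. *)
pose E u v : {mpoly R[n]} := c *+ ((u == s) && (v == t)) + c *+ ((u == t) && (v == s)).
exists (fun u v => P u v + E u v); split.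
- move=> u v; rewrite h1 /E [X in _ + X = _]addrC.
  by congr (_ + (_ *+ (nat_of_bool _) + _ *+ (nat_of_bool _))); exact: andbC.
- move=> u v uv euv; rewrite h2 // add0r /E.
  have [us|us] /= := eqVneq u s.
    have [vt|vt] /= := eqVneq v t.
      by move: uv euv; rewrite us vt => /est ->.
    have [vs|vs] /= := eqVneq v s; first by rewrite us vs eqxx in uv.
    by rewrite andbF addr0.
  have [ut|ut] /= := eqVneq u t; last by rewrite addr0.
  have [vs|vs] /= := eqVneq v s; last by rewrite addr0.
  by move: uv euv; rewrite ut vs eq_sym esym => /est ->.
- have splitE u0 v0 : \sum_u \sum_v (c *+ ((u == u0) && (v == v0))) *: 'X_[mon u + mon v]
  = c *: 'X_[mon u0 + mon v0] :> xypoly R n m.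
    rewrite (bigD1 u0) //= (bigD1 v0) //= !eqxx /= !big1 ?addr0 // => [u /negPf u_ne|v
      /negPf v_ne].
      by rewrite big1 // => v _; rewrite u_ne scale0r.
    by rewrite v_ne scale0r.
  rewrite /gram; under eq_bigr => u _.
    under eq_bigr => v _ do rewrite scalerDl /E scalerDl.
    rewrite big_split big_split /=; over.
  rewrite big_split big_split /= !splitE h3 addrC; congr (_ + _).
  rewrite bE [(mon t + _)%MM]addmC -scalerDl; congr (_ *: _).
  have half : 2^-1 + 2^-1 = 1 :> R by field.
  by rewrite /c bE -scalerDl half scale1r.
- move=> k hk u v; apply: rpredD; first exact: h4.
  by apply: rpredD; apply: rpredMn; apply: rpredZ; apply: hk.
Qed.

End Gram.

Lemma csp_graph_sym p : symmetric (csp_graph p).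
Proof.
move=> i j; rewrite /csp_graph !mxE [j == i]eq_sym;
  congr (_ && (nat_of_bool (_ || _) == _)).
by apply: boolp.asbool_equiv_eq; split=> -[a [b [h1 h2]]]; exists a, b; rewrite mulnC.
Qed.

Lemma csp_graph_irr p : irreflexive (csp_graph p).
Proof. by move=> i; rewrite /csp_graph eqxx. Qed.

Lemma csp_graph_supp p b i j : b \in msupp p -> b i != 0%N -> b j != 0%N ->
  i != j -> csp_graph p i j.
Proof.
move=> bp bi bj ij; rewrite /csp_graph ij mxE (negPf ij) /= eqb1; apply/boolp.asboolP.
have : p@_b != 0 by rewrite -mcoeff_msupp.
rewrite [p@_b]mpolyE => h.
have : exists a, (p@_b)@_a != 0.
  apply: boolp.contrapT => /boolp.forallNP h'.
  case/negP: h; rewrite big1 // => a _.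
  by have /negP/negPn/eqP -> := h' a; rewrite scale0r.
by case=> a ha; exists a, b; rewrite muln_eq0 negb_or bi bj.
Qed.

Definition affine_mon (o : option 'I_m) : 'X_{1..m} :=
  if o is Some i then U_(i)%MM else 0%MM.

Lemma quadratic_supp p b : b \in msupp p -> mdeg b = 2 ->
  exists i j, b = (U_(i) + U_(j))%MM /\ (i != j -> csp_graph p i j).
Proof.
move=> bp /mdegS_split[i [b1 [bE b1d]]].
have /mdeg1P[j /eqP b1E] : mdeg b1 == 1%N by rewrite b1d.
exists i, j; rewrite bE b1E; split=> // ij; apply: csp_graph_supp bp _ _ ij.
  by rewrite bE b1E mnmDE !mnm1E eqxx.
by rewrite bE b1E mnmDE !mnm1E eqxx addnC.
Qed.

Lemma homogeneous_gram p : p \is 2.-homog ->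
  exists P, [/\ symm P, sparse (csp_graph p) P, p = gram (fun i => U_(i)%MM) P,
    forall k, (forall b, p@_b \is k.-homog) -> forall u v, P u v \is k.-homog &
    forall X, condition_a p X -> forall x, X x -> posdef (eval_matrix P x)].
Proof.
move=> p2; have [|P [h1 h2 h3 h4]] := @gram_matrix _ _ (fun i => U_(i)%MM)
  (@csp_graph_sym p) p.
  by move=> b bp; apply: quadratic_supp => //; exact: dhomog_mf bp.
exists P; split=> // X ha x Xx z [u zu].
have := ha x (\row_i z i) Xx; rewrite /quadratic_part pihomog_dE // h3 evalxy_gram.
rewrite (_ : (fun _ => _) = z); last first.
  by apply: boolp.funext => i; rewrite mevalXU mxE.
by apply; apply: contra zu => /eqP/rowP/(_ u); rewrite !mxE => ->.
Qed.

(** For positive definiteness at [z]: if [z None] is nonzero, scaling it to 1 reduces to condition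
    (b); otherwise only the quadratic part remains, and condition (a) applies. *)
Lemma inhomogeneous_gram p : quadratic_y p ->
  exists P, [/\ symm P, sparse (cone_graph (csp_graph p)) P, p = gram affine_mon P,
    forall k, (forall b, p@_b \is k.-homog) -> forall u v, P u v \is k.-homog &
    forall X, condition_a p X -> condition_b p X -> ~ homog_y p ->
      forall x, X x -> posdef (eval_matrix P x)].
Proof.
move=> p2; have [|P [h1 h2 h3 h4]] := @gram_matrix _ _ affine_mon (cone_graph_sym
  (@csp_graph_sym p)) p.
  move=> b bp; have := p2 b; rewrite -mcoeff_msupp => /(_ bp).
  case bd : (mdeg b) => [|[|[|//]]] _.
  - exists None, None; split=> //; rewrite /= addm0; apply/eqP.
    by rewrite -mdeg_eq0 bd.
  - have /mdeg1P[j /eqP ->] : mdeg b == 1%N by rewrite bd.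
    by exists None, (Some j); rewrite /= add0m.
  - have [i [j [-> ij]]] := quadratic_supp bp bd.
    by exists (Some i), (Some j).
exists P; split=> // X ha hb pnh x Xx z [u zu].
have [z0|z0] := eqVneq (z None) 0; last first.
  have := hb pnh x (\row_i (z (Some i) / z None)) Xx.
  rewrite {1}h3 evalxy_gram (_ : (fun _ => _) = fun u => (z None)^-1 * z u).
    by rewrite qformZ pmulr_rgt0 // exprn_even_gt0 // invr_eq0 z0 orbT.
  apply: boolp.funext => -[i|] /=; first by rewrite mevalXU mxE mulrC.
  by rewrite mpolyX0 meval1 mulVf.
have := ha x (\row_i z (Some i)) Xx.
have -> : evalxy (quadratic_part p) x (\row_i z (Some i)) = qform (eval_matrix P x) z.
  rewrite h3 /quadratic_part /gram raddf_sum evalxy_sum; apply: eq_bigr => s _.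
  rewrite raddf_sum evalxy_sum; apply: eq_bigr => t _ /=; rewrite linearZ /= pihomogX.
  rewrite [X in X == 2%N](mdegD (affine_mon s) (affine_mon t)).
  case: s t => [s|] [t|] /=; rewrite ?mdeg1 ?mdeg0 /=.
  - by rewrite evalxyZX mpolyXD mevalM !mevalXU !mxE.
  - by rewrite scaler0 z0 !mulr0 /evalxy /evalx !raddf0.
  - by rewrite scaler0 z0 mul0r mulr0 /evalxy /evalx !raddf0.
  - by rewrite scaler0 z0 mul0r mulr0 /evalxy /evalx !raddf0.
apply; apply: contra zu => /eqP/rowP zi.
by case: u => [i|]; [have := zi i; rewrite !mxE => ->|rewrite z0].
Qed.

End GramMatrix.

(** * Sparse representations *)

Lemma sum_option (I : finType) (A : nmodType) (F : option I -> A) :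
  \sum_o F o = F None + \sum_i F (Some i).
Proof.
rewrite (bigD1 None) //=; congr (_ + _).
rewrite (reindex_omap Some id) //=; last by case.
by apply: eq_bigl => i; rewrite /= eqxx.
Qed.

Section SparseRepresentation.
Variables (R : realType) (n m q t : nat) (g : 'I_q -> {mpoly R[n]}).
Variable (C : 'I_t -> {set 'I_m}).
Implicit Types (f : xypoly R n m).

Local Notation rep := (sparse_sos_representation g C).

Lemma quadratic_yD k (f1 f2 : xypoly R n k) :
  quadratic_y f1 -> quadratic_y f2 -> quadratic_y (f1 + f2).
Proof.
move=> h1 h2 b; rewrite mcoeffD; have [->|/h1//] := eqVneq (f1@_b) 0.
by rewrite add0r; apply: h2.
Qed.

Lemma quadratic_y0 k : quadratic_y (0 : xypoly R n k).
Proof. by move=> b; rewrite mcoeff0 eqxx. Qed.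

Lemma on_clique0 (S : {set 'I_m}) : on_clique (0 : xypoly R n #|S|) = 0.
Proof. exact: comp_mpoly0. Qed.

Lemma rep0 : rep 0.
Proof.
exists (fun=> 0), (fun _ _ => 0); split=> [k|j k|].
- by split; [exact: sos0|exact: quadratic_y0].
- by split; [exact: sos0|exact: quadratic_y0].
- rewrite big1 // => k _; rewrite /= on_clique0 add0r big1 // => j _.
  by rewrite /= ?on_clique0 mulr0.
Qed.

Lemma repD f1 f2 : rep f1 -> rep f2 -> rep (f1 + f2).
Proof.
move=> [s0 [s [hs0 hs ->]]] [r0 [r [hr0 hr ->]]].
exists (fun k => s0 k + r0 k), (fun j k => s j k + r j k); split=> [k|j k|].
- have [? ?] := hs0 k; have [? ?] := hr0 k.
  by split; [exact: sosD|exact: quadratic_yD].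
- have [? ?] := hs j k; have [? ?] := hr j k.
  by split; [exact: sosD|exact: quadratic_yD].
- rewrite -big_split /=; apply: eq_bigr => k _.
  rewrite /on_clique comp_mpolyD addrACA -big_split /=; congr (_ + _).
  by apply: eq_bigr => j _; rewrite comp_mpolyD mulrDr.
Qed.

Lemma rep_sum (I : Type) (r : seq I) (F : I -> xypoly R n m) :
  (forall i, rep (F i)) -> rep (\sum_(i <- r) F i).
Proof.
move=> h; elim/big_rec: _ => [|i f _ hf]; first exact: rep0.
exact: repD.
Qed.

Section AffineSquare.
Variables (c0 : {mpoly R[n]}) (c : 'I_m -> {mpoly R[n]}) (k : 'I_t).
Hypothesis hc : forall i, i \notin C k -> c i = 0.

Definition affine : xypoly R n m := c0%:MP + \sum_i c i *: 'X_i.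

(** Defined for every [k'], not just for [k], so that it can be selected by [*+ (k' == k)] in a
    dependent family without transporting types. *)
Definition clique_affine k' : xypoly R n #|C k'| :=
  c0%:MP + \sum_(i < #|C k'|) c (enum_val i) *: 'X_i.

Lemma on_clique_affine : on_clique (clique_affine k) = affine.
Proof.
rewrite /on_clique /clique_affine /affine comp_mpolyD comp_mpolyC; congr (_ + _).
rewrite raddf_sum /= (bigID (fun i => i \in C k)) /= [X in _ + X]big1 ?addr0; last first.
  by move=> i /hc ->; rewrite scale0r.
rewrite [RHS]big_enum_val; apply: eq_bigr => i _.
by rewrite linearZ /= comp_mpolyXU -tnth_nth tnth_mktuple.
Qed.

Lemma quadratic_clique_affine k' : quadratic_y (clique_affine k' ^+ 2).
Proof.
have h (b : 'X_{1..#|C k'|}) : b \in msupp (clique_affine k') -> (mdeg b <= 1)%N.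
  move=> /msuppD_le; rewrite mem_cat => /orP[|/msupp_sum_le].
    by rewrite msuppC; case: ifP => // _; rewrite inE => /eqP ->; rewrite mdeg0.
  move=> /flattenP[s /mapP[i _ ->]] /msuppZ_le; rewrite msuppX inE => /eqP ->.
  by rewrite mdeg1.
move=> b; rewrite -mcoeff_msupp expr2 => /msuppM_le/allpairsP[[b1 b2] /= [/h h1 /h h2 ->]].
by rewrite mdegD (leq_add h1 h2).
Qed.

Lemma rep_affine_sq : rep (affine ^+ 2).
Proof.
exists (fun k' => clique_affine k' ^+ 2 *+ (k' == k)), (fun _ _ => 0); split=> [k'|j k'|].
- case: (k' == k); last by split; [exact: sos0|exact: quadratic_y0].
  by split; [exact: sos_sq|exact: quadratic_clique_affine].
- by split; [exact: sos0|exact: quadratic_y0].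
- rewrite (bigD1 k) //= eqxx mulr1n [X in _ + X]big1 ?addr0; last first.
    move=> k' /negPf ->; rewrite /= mulr0n on_clique0 add0r big1 // => j _.
    by rewrite /= ?on_clique0 mulr0.
  rewrite big1 ?addr0; last by move=> j _; rewrite /= ?on_clique0 mulr0.
  by rewrite -on_clique_affine /on_clique rmorphXn.
Qed.

Lemma rep_gen_affine_sq j : rep ((g j)%:MP * affine ^+ 2).
Proof.
exists (fun=> 0), (fun j' k' => clique_affine k' ^+ 2 *+ ((k' == k) && (j' == j)));
  split=> [k'|j' k'|].
- by split; [exact: sos0|exact: quadratic_y0].
- case: (_ && _); last by split; [exact: sos0|exact: quadratic_y0].
  by split; [exact: sos_sq|exact: quadratic_clique_affine].
- rewrite (bigD1 k) //= [X in _ + X]big1 ?addr0; last first.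
    move=> k' /negPf ->; rewrite /= on_clique0 add0r big1 // => j' _.
    by rewrite /= ?mulr0n ?on_clique0 mulr0.
  rewrite /= on_clique0 add0r (bigD1 j) //= big1 ?addr0; last first.
    by move=> j' /negPf ->; rewrite /= andbF ?mulr0n ?on_clique0 mulr0.
  by rewrite !eqxx mulr1n -on_clique_affine /on_clique rmorphXn.
Qed.

End AffineSquare.

Section Assemble.
Variables (V : finType) (e : rel V) (mon : V -> 'X_{1..m}).
Hypotheses (esym : symmetric e) (eelim : eliminable e).
Hypothesis lin : forall w : V -> R, clique e [set v | w v != 0] -> forall a : {mpoly R[n]},
  exists k c0 c, (forall i, i \notin C k -> c i = 0) /\
    a *: (\sum_v (w v)%:MP *: 'X_[mon v]) = affine c0 c.

(** The weight reduces to [a ^+ 2] or [g j * a ^+ 2], and [a ^+ 2] is absorbed into the square: [a]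
    times the linear form is affine on a single clique. *)
Lemma rep_quadratic_module (w : V -> R) (b : {mpoly R[n]}) :
  clique e [set v | w v != 0] -> quadratic_module g b ->
  rep (b *: (\sum_v (w v)%:MP *: 'X_[mon v]) ^+ 2).
Proof.
move=> cw; set L := \sum_v _.
apply: (@quadratic_module_ind _ _ g (fun b => rep (b *: L ^+ 2))).
- by rewrite scale0r; exact: rep0.
- by move=> b1 b2 h1 h2; rewrite scalerDl; exact: repD.
- move=> a; have [k [c0 [c [hc E]]]] := lin cw a.
  by rewrite -exprZn E; exact: rep_affine_sq hc.
- move=> j a; have [k [c0 [c [hc E]]]] := lin cw a.
  rewrite -scalerA -exprZn E -mul_mpolyC; exact: rep_gen_affine_sq hc _.
Qed.

Lemma rep_gram (P : V -> V -> {mpoly R[n]}) :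
  sos_decomposition e (quadratic_module g) P -> rep (gram mon P).
Proof.
move=> [I [b [D [hb Dsym Dsp Dpos PE]]]].
have -> : gram mon P = \sum_i b i *: \sum_u \sum_v (D i u v)%:MP *: 'X_[mon u + mon v].
  under [RHS]eq_bigr do rewrite scaler_sumr.
  rewrite exchange_big /=; apply: eq_bigr => u _.
  under [RHS]eq_bigr do rewrite scaler_sumr.
  rewrite exchange_big /=; apply: eq_bigr => v _.
  rewrite PE scaler_suml; apply: eq_bigr => i _.
  by rewrite scalerA mulrC mul_mpolyC.
apply: rep_sum => i; have [ws wsc wsE] := sparse_cholesky esym eelim (Dsym i) (Dsp i)
  (Dpos i).
have -> : \sum_u \sum_v (D i u v)%:MP *: 'X_[mon u + mon v] =
   \sum_(l < size ws) (\sum_v (nth (fun=> 0) ws l v)%:MP *: 'X_[mon v]) ^+ 2 :> xypoly R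
     n m.
  under [RHS]eq_bigr => l _.
    rewrite expr2 mulr_suml.
    under eq_bigr => u _ do rewrite mulr_sumr.
    over.
  rewrite [RHS]exchange_big /=; apply: eq_bigr => u _.
  rewrite [RHS]exchange_big /=; apply: eq_bigr => v _.
  rewrite wsE (big_nth (fun=> 0)) big_mkord raddf_sum scaler_suml; apply: eq_bigr => l _.
  by rewrite /= mpolyCM mpolyXD -scalerAl -scalerAr scalerA.
rewrite scaler_sumr; apply: rep_sum => l.
by apply: rep_quadratic_module => //; apply: wsc.
Qed.

End Assemble.

Section CliqueForms.
Variables (e : rel 'I_m).
Hypothesis hC : forall S : {set 'I_m}, maximal_clique e S <-> exists k, C k = S.

Lemma clique_cover (S : {set 'I_m}) : clique e S -> exists k, S \subset C k.
Proof.
move=> cS; have [B maxB SB] := maxset_exists cS.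
by have [k kB] := (hC B).1 maxB; exists k; rewrite kB.
Qed.

Lemma linear_form_affine (w : 'I_m -> R) (a : {mpoly R[n]}) :
  clique e [set v | w v != 0] ->
  exists k c0 c, (forall i, i \notin C k -> c i = 0) /\
    a *: (\sum_v (w v)%:MP *: 'X_v) = affine c0 c.
Proof.
move=> /clique_cover[k Sk]; exists k, 0, (fun i => a * (w i)%:MP); split=> [i iC|].
  have /eqP -> : w i == 0.
    by apply: contraNT iC => wi; apply: (subsetP Sk); rewrite inE.
  by rewrite mpolyC0 mulr0.
rewrite /affine mpolyC0 add0r scaler_sumr; apply: eq_bigr => v _.
by rewrite scalerA.
Qed.

(** A clique of the cone without its apex is a clique of [e]; the coefficient at the apex becomes
    the constant term. *)
Lemma affine_form_affine (w : option 'I_m -> R) (a : {mpoly R[n]}) :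
  clique (cone_graph e) [set v | w v != 0] ->
  exists k c0 c, (forall i, i \notin C k -> c i = 0) /\
    a *: (\sum_v (w v)%:MP *: 'X_[affine_mon v]) = affine c0 c.
Proof.
move=> cw; have : clique e [set v | w (Some v) != 0].
  apply/forall_inP => i; rewrite inE => wi; apply/forall_inP => j; rewrite inE => wj.
  apply/implyP => ij; move/forall_inP/(_ (Some i)): cw; rewrite inE => /(_ wi).
  by move=> /forall_inP/(_ (Some j)); rewrite inE => /(_ wj)/implyP/(_ ij).
move=> /clique_cover[k Sk]; exists k, (a * (w None)%:MP), (fun i => a * (w (Some i))%:MP).
split=> [i iC|].
  have /eqP -> : w (Some i) == 0.
    by apply: contraNT iC => wi; apply: (subsetP Sk); rewrite inE.
  by rewrite mpolyC0 mulr0.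
rewrite /affine sum_option /= mpolyX0 scalerDr; congr (_ + _).
  by rewrite scalerA -mul_mpolyC mulr1.
rewrite scaler_sumr; apply: eq_bigr => v _.
by rewrite scalerA.
Qed.

End CliqueForms.

End SparseRepresentation.

(** Hides whether [p] is homogeneous of degree 2 in [y], so that both parts of the theorem are
    proved without this case distinction. *)
Lemma exists_gram_representation (R : realType) (n m q t : nat) (hm : (0 < m)%N)
    (p : xypoly R n m) (hdy : quadratic_y p) (g : 'I_q -> {mpoly R[n]})
    (hchordal : chordal (csp_graph p)) (C : 'I_t -> {set 'I_m})
    (hC : forall S : {set 'I_m},
        maximal_clique (csp_graph p) S <-> exists k : 'I_t, C k = S)
    (X : set 'rV[R]_n) : condition_a p X -> condition_b p X ->
  exists (V : finType) (e : rel V) (mon : V -> 'X_{1..m}) (P : V -> V -> {mpoly R[n]}),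
    [/\ symm P, sparse e P, p = gram mon P,
        forall x, X x -> posdef (eval_matrix P x) &
       (forall k, (forall b, p@_b \is k.-homog) -> forall u v, P u v \is k.-homog) /\
       forall Q, sos_decomposition e (quadratic_module g) Q ->
          sparse_sos_representation g C (gram mon Q)].
Proof.
move=> ha hb.
have eelim := chordal_eliminable (@csp_graph_sym _ _ _ p) (@csp_graph_irr _ _ _ p) hchordal.
have [p2|p2] := boolP (p \is 2.-homog).
  have [P [h1 h2 h3 h4 h5]] := homogeneous_gram p2.
  exists 'I_m, (csp_graph p), (fun i => U_(i)%MM), P; split=> //.
    exact: h5.
  split=> // Q; apply: rep_gram => //; first exact: csp_graph_sym.
  by move=> w cw a; apply: linear_form_affine cw.
have [P [h1 h2 h3 h4 h5]] := inhomogeneous_gram hdy.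
exists (option 'I_m), (cone_graph (csp_graph p)), (@affine_mon m), P; split=> //.
  (* If [p] were homogeneous in [y], of degree other than 2, its quadratic part would be 0,
     contradicting (a) at the vector of ones, which is nonzero because [0 < m]. *)
  move=> x Xx; apply: (h5 X ha hb) => // -[k pk].
  have := ha x (const_mx 1) Xx; rewrite /quadratic_part (@pihomog_ne0 _ _ _ k);
    last exact: pk.
    rewrite /evalxy /evalx !meval0 ltxx => /(_ _)/notF; apply.
    by apply/eqP => /rowP/(_ (Ordinal hm)); rewrite !mxE => /eqP; rewrite oner_eq0.
  by apply: contra p2 => /eqP <-.
split=> // Q; apply: rep_gram; [apply: cone_graph_sym;
  exact: csp_graph_sym|exact: cone_graph_eliminable|].
by move=> w cw a; apply: affine_form_affine cw.
Qed.

Theorem corollary4p3 (R : realType) (n m d q t : nat) (hm : (0 < m)%N)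
    (p : xypoly R n m)
    (hdx : forall (a : 'X_{1..n}) (b : 'X_{1..m}),
        coefxy p a b != 0 -> (mdeg a <= d)%N)
    (hdy : quadratic_y p)
    (g : 'I_q -> {mpoly R[n]})
    (hchordal : chordal (csp_graph p))
    (C : 'I_t -> {set 'I_m})
    (hCinj : injective C)
    (hC : forall S : {set 'I_m},
        maximal_clique (csp_graph p) S <-> exists k : 'I_t, C k = S) :
  let K := basic_set g in
  let K0 : set 'rV[R]_n := classical_sets.setD K (classical_sets.set1 0) in
  (condition_a p K -> condition_b p K -> compact K -> archimedean g ->
   sparse_sos_representation g C p)
  /\
  (even_homog_x p -> (forall j, even_homog (g j)) ->
   (exists x, K0 x) ->
   condition_a p K0 -> condition_b p K0 ->
   exists nu : nat,
     sparse_sos_representation g C ((sqnorm_x ^+ nu)%:MP * p)).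
Proof.
move=> K K0; have qM := quadratic_moduleP g; split.
  move=> ha hb _ [s0 [s [r [hs0 hs E]]]].
  have [V [e [mon [P [h1 h2 h3 h4 [_ h5]]]]]] :=
    exists_gram_representation hm hdy g hchordal hC ha hb.
  rewrite h3; apply: h5; apply: (archimedean_sos_decomposition (rho := r ^+ 2) (g := g)) => //.
    by exists s0, s; split.
  exact: quadratic_module_gen.
move=> [k kodd pk] geven _ ha hb.
have [V [e [mon [P [h1 h2 h3 h4 [h6 h5]]]]]] :=
  exists_gram_representation hm hdy g hchordal hC ha hb.
pose N : {mpoly R[n]} := sqnorm_x.
have Nhom : N \is 2.-homog.
  apply: rpred_sum => i _; rewrite mpolyXn dhomogX; apply/eqP.
  by rewrite [LHS]mdegMn mdeg1.
have Nsos : sos N by apply: sos_sum => i; apply: sos_sq.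
pose M := add_ideal N (quadratic_module g).
have MQ f : quadratic_module g f -> M f by move=> hf; exists f, 0; rewrite mulr0 addr0.
have MN a : M ((1 - N) * a) by exists 0, a; rewrite add0r; split => //; exact: (qm0 qM).
(* The set where all [G o] are nonnegative is the intersection of [K] with the unit sphere. *)
pose G (o : option (option 'I_q)) := match o with
  None => 1 - N | Some None => N - 1 | Some (Some j) => g j end.
have [|nu] := @sos_decomposition_homog _ _ N Nhom _ g Nsos geven V e P k kodd (h6 k pk).
- apply: (archimedean_sos_decomposition (rho := 1) (g := G)) => //.
  + exact: add_idealP.
  + by rewrite mpolyC1 -[1 - _]mulr1; exact: MN.
  + case=> [[j|]|] /=; first exact/MQ/quadratic_module_gen.
      by rewrite (_ : N - 1 = (1 - N) * - 1); [exact: MN|ring].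
    by rewrite -[1 - _]mulr1; exact: MN.
  (* A point of the sphere is nonzero, since [N - 1] is negative at 0; so it lies in [K0]. *)
  + move=> x hx; apply: h4; split.
      by move=> j; have := hx (Some (Some j)).
    move=> x0; have := hx (Some None); rewrite /= /evalx mevalB meval1 x0.
    rewrite /N /sqnorm_x raddf_sum big1 /=; first by rewrite sub0r oppr_ge0 ler10.
    by move=> i _; rewrite rmorphXn /= mevalXU mxE expr0n.
move=> hQ; exists nu; have := h5 _ hQ.
rewrite (_ : gram mon _ = (sqnorm_x ^+ nu)%:MP * p) //.
rewrite h3 mul_mpolyC /gram scaler_sumr; apply: eq_bigr => u _.
by rewrite scaler_sumr; apply: eq_bigr => v _; rewrite scalerA.
Qed.
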